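(* Let $\gamma\ge1$, $s,t\in(1,\infty)$, and let $T$ be an operator that satisfies the $(\mathsf L^1(\gamma Q),\mathsf L^1(\gamma Q))$ convex body domination. Let $\vec a,\vec b\in L^1_{\mathrm{loc}}(\mathbb R^d)^n$ be functions such that $$A_{s,t}:=\sup_Q\big\|(x,y)\mapsto\vec a(x)\cdot\vec b(y)\big\|_{\mathsf L^{(s,t)}_{\min}(Q\times Q)}<\infty,$$ where the supremum is over all cubes $Q\subset\mathbb R^d$. Then the operator $\vec a\cdot T\vec b:f\mapsto\sum_{i=1}^na_iT(b_if)$ extends to a bounded operator on $L^p(\mathbb R^d)$ for all $p\in(t',s)$. In particular, if $A_s:=A_{s,s}<\infty$ for some $s\in(2,\infty)$, then $\vec a\cdot T\vec b$ extends boundedly to $L^2(\mathbb R^d)$.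
   Context: All functions are real-valued; $t'=t/(t-1)$ is the conjugate exponent. $\mathsf L^p(Q)$ is $L^p(Q)$ with the normalised norm $\|f\|_{\mathsf L^p(Q)}=|Q|^{-1/p}\|f\|_{L^p(Q)}$; $\gamma Q$ is the cube concentric with $Q$ with $\gamma$ times its side length. With averages $⨍_Q$ written as $\frac1{|Q|}\int_Q$, $$\|\Phi\|_{\mathsf L^{(s,t)}_{\min}(Q\times Q)}:=\begin{cases}\Big(\frac1{|Q|}\int_Q\big[\frac1{|Q|}\int_Q|\Phi(x,y)|^s\,dx\big]^{t/s}dy\Big)^{1/t},&s\le t,\\ \Big(\frac1{|Q|}\int_Q\big[\frac1{|Q|}\int_Q|\Phi(x,y)|^t\,dy\big]^{s/t}dx\Big)^{1/s},&t\le s.\end{cases}$$ For a normed space $X$ with closed dual unit ball $\bar B_{X^*}$ and $\vec x\in X^n$, $\langle\!\langle\vec x\rangle\!\rangle_X:=\{(\langle x_i,x^*\rangle)_{i=1}^n:x^*\in\bar B_{X^*}\}\subset\mathbb R^n$ (convex, compact, symmetric); for functions on $\mathbb R^d$ and $X$ a space of functions on a cube, restrictions to the cube are understood. For convex compact symmetric $A,B\subset\mathbb R^n$, $A\cdot B:=\{\vec a\cdot\vec b:\vec a\in A,\vec b\in B\}=[-r,r]$ is identified with $r\ge0$. A collection $\mathscr S$ of cubes is $\delta$-sparse ($\delta>0$) if there are pairwise disjoint measurable $E(Q)\subset Q$, $Q\in\mathscr S$, with $|E(Q)|\ge\delta|Q|$. Let $\mathscr D$ be a dyadic system of cubes in $\mathbb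 R^d$. Given normed spaces $X(Q),Y(Q)$ for each $Q\in\mathscr D$, a bilinear form $\tau:F\times G\to\mathbb R$ satisfies the $(X(Q),Y(Q))$ convex body domination if $F\subseteq X(Q)$, $G\subseteq Y(Q)$ for every $Q\in\mathscr D$ and, for every $n\in\mathbb N$, there are constants $C_n<\infty$, $\delta_n>0$ such that for every $(\vec f,\vec g)\in F^n\times G^n$ there is a $\delta_n$-sparse $\mathscr S\subset\mathscr D$ with $$|\tau(\vec f,\vec g)|\le C_n\sum_{Q\in\mathscr S}|Q|\,\langle\!\langle\vec f\rangle\!\rangle_{X(Q)}\cdot\langle\!\langle\vec g\rangle\!\rangle_{Y(Q)},\qquad \tau(\vec f,\vec g):=\sum_{i=1}^n\tau(f_i,g_i).$$ An operator $T:F\to G^*$ satisfies this if its form $\tau(f,g):=\langle Tf,g\rangle$ does. Here $F,G$ are function spaces on $\mathbb R^d$ containing $L^\infty_c(\mathbb R^d)$ (bounded compactly supported functions). The operator $\vec a\cdot T\vec b$ is defined through its form $\langle\vec a\cdot T(\vec bf),g\rangle=\sum_{i=1}^n\langle T(b_if),a_ig\rangle=\tau(\vec bf,\vec ag)$ for $f\in F_{\vec b}:=\{f\in F:b_if\in F\ \forall i\}$ and $g\in G_{\vec a}:=\{g\in G:a_ig\in G\ \forall i\}$. That it extends to a bounded operator on $L^p(\mathbb R^d)$ means that $|\langle\vec a\cdot T(\vec bf),g\rangle|\le C\|f\|_{L^p}\|g\|_{L^{p'}}$ for all $f\in F_{\vec b}\cap L^p(\mathbb R^d)$, $g\in G_{\vec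 a}\cap L^{p'}(\mathbb R^d)$ (these being dense subspaces of $L^p(\mathbb{R}^d)$ and $L^{p'}(\mathbb{R}^d)$). *)

(* Defs.v *)
From HB Require Import structures.
From mathcomp Require Import all_boot all_order all_algebra.
From mathcomp Require Import all_classical all_reals all_analysis.
Set Implicit Arguments.
Unset Strict Implicit.
Unset Printing Implicit Defensive.
Import Order.TTheory GRing.Theory Num.Theory.
Import numFieldNormedType.Exports.
Local Open Scope classical_set_scope.
Local Open Scope ring_scope.

(* Points of R^d are d-tuples, because that is where the library puts the
   product sigma-algebra (here: the Borel sets of R^d). *)
Notation Rd R d := (d.-tuple (measurableTypeR R)).

(** Lebesgue measure on R^d: the d-fold product of [lebesgue_measure]. *)
Section LebesgueMeasureRd.
Context {R : realType}.
Local Open Scope ereal_scope.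

Definition consRd n (p : measurableTypeR R * Rd R n) : Rd R n.+1 :=
  [the n.+1.-tuple (measurableTypeR R) of p.1 :: p.2].

Lemma measurable_consRd n : measurable_fun setT (@consRd n).
Proof. by apply: measurable_cons. Qed.

Let product_sigma_finite d1 d2 (T1 : measurableType d1) (T2 : measurableType d2)
    (m1 : {sigma_finite_measure set T1 -> \bar R})
    (m2 : {sigma_finite_measure set T2 -> \bar R}) :
  sigma_finite setT (m1 \x m2).
Proof.
have /sigma_finiteP[F [TF ndF Foo]] := sigma_finiteT m1.
have /sigma_finiteP[G [TG ndG Goo]] := sigma_finiteT m2.
exists (fun n => F n `*` G n).
  rewrite -setXTT TF TG predeqE => -[x y]; split.
    move=> [/= [n _ Fnx] [k _ Gky]]; exists (maxn n k) => //; split.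
    - by move: x Fnx; exact/subsetPset/ndF/leq_maxl.
    - by move: y Gky; exact/subsetPset/ndG/leq_maxr.
  by move=> [n _ []/= ? ?]; split; exists n.
move=> k; have [? ?] := Foo k; have [? ?] := Goo k.
split; first exact: measurableX.
by rewrite product_measure1E// lte_mul_pinfty// ge0_fin_numE.
Qed.

Section succ.
Variables (n : nat) (m : {sigma_finite_measure set (Rd R n) -> \bar R}).

Definition lebesgueRd_succ : set (Rd R n.+1) -> \bar R :=
  pushforward (lebesgue_measure \x m) (@consRd n).

Let measurable_pre A : measurable A -> measurable (@consRd n @^-1` A).
Proof. by move=> mA; rewrite -[X in measurable X]setTI; exact: measurable_consRd. Qed.

Let succ0 : lebesgueRd_succ set0 = 0.
Proof. by rewrite /lebesgueRd_succ /pushforward preimage_set0 measure0. Qed.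

Let succ_ge0 A : 0 <= lebesgueRd_succ A.
Proof. by rewrite /lebesgueRd_succ /pushforward; exact: measure_ge0. Qed.

Let succ_sigma_additive : semi_sigma_additive lebesgueRd_succ.
Proof.
move=> F mF tF mUF; rewrite /lebesgueRd_succ /pushforward preimage_bigcup.
apply: measure_semi_sigma_additive.
- by move=> k; exact: measurable_pre.
- apply/trivIsetP => /= i j _ _ ij; rewrite -preimage_setI.
  by move/trivIsetP : tF => /(_ _ _ _ _ ij) ->//; rewrite preimage_set0.
- by rewrite -preimage_bigcup; exact: measurable_pre.
Qed.

HB.instance Definition _ := isMeasure.Build _ _ _ lebesgueRd_succ
  succ0 succ_ge0 succ_sigma_additive.

Lemma lebesgueRd_succE (A : set (measurableTypeR R)) (B : set (Rd R n)) :
  measurable A -> measurable B ->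
  lebesgueRd_succ [set x | A (thead x) /\ B [tuple of behead x]]
    = lebesgue_measure A * m B.
Proof.
move=> mA mB; rewrite -product_measure1E// /lebesgueRd_succ /pushforward.
congr (_ _); apply/seteqP; split=> -[x y] /=; rewrite theadE.
  by move=> [? By]; split=> //; move: By; congr (B _); exact/val_inj.
by move=> [? By]; split=> //; move: By; congr (B _); exact/val_inj.
Qed.

Let succ_sigma_finite : sigma_finite setT lebesgueRd_succ.
Proof.
have [F FT Ff] := product_sigma_finite lebesgue_measure m.
pose uncons (x : Rd R n.+1) : measurableTypeR R * Rd R n :=
  (thead x, [tuple of behead x]).
have unconsK : cancel uncons (@consRd n).
  by move=> x; apply/val_inj; rewrite /= [in RHS](tuple_eta x).
have consRdK : cancel (@consRd n) uncons.
  by move=> [x y]; rewrite /uncons theadE; congr pair; exact/val_inj.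
have muncons : measurable_fun setT uncons.
  apply/measurable_fun_pairP; split; first exact: measurable_tnth.
  exact: measurable_behead.
exists (fun k => uncons @^-1` F k).
  by rewrite -preimage_bigcup -FT preimage_setT.
move=> k; have [mF Foo] := Ff k; split.
  by rewrite -[X in measurable X]setTI; exact: muncons.
rewrite /lebesgueRd_succ /pushforward -comp_preimage.
by rewrite (_ : _ \o _ = id) //; apply/funext => p /=; rewrite consRdK.
Qed.

HB.instance Definition _ := Measure_isSigmaFinite.Build _ _ _ lebesgueRd_succ
  succ_sigma_finite.

End succ.

Fixpoint lebesgueRd d : {sigma_finite_measure set (Rd R d) -> \bar R} :=
  match d with
  | 0 => \d_ ([tuple] : Rd R 0)
  | n.+1 => lebesgueRd_succ (lebesgueRd n)
  end.

Lemma measurable_boxRd d (A : 'I_d -> set (measurableTypeR R)) :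
  (forall i, measurable (A i)) ->
  measurable [set x : Rd R d | forall i, A i (tnth x i)].
Proof.
move=> mA; rewrite (_ : [set _ | _] =
    \bigcap_(i in [set: 'I_d]) ((fun x : Rd R d => tnth x i) @^-1` A i)).
  apply: fin_bigcap_measurable => // i _; rewrite -[X in measurable X]setTI.
  exact: measurable_tnth.
by apply/seteqP; split=> [x Ax i _|x Ax i]; exact: Ax.
Qed.

Lemma lebesgueRd_box d (A : 'I_d -> set (measurableTypeR R)) :
  (forall i, measurable (A i)) ->
  lebesgueRd d [set x | forall i, A i (tnth x i)]
    = \prod_(i < d) lebesgue_measure (A i).
Proof.
elim: d A => [|n IH] A mA.
  by rewrite big_ord0 /= diracE mem_set// => -[].
have mB := @measurable_boxRd n (fun i => A (lift ord0 i)) (fun i => mA _).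
rewrite big_ord_recl -IH//= -(lebesgueRd_succE _ (mA ord0) mB).
have tnth_behead (x : Rd R n.+1) i :
    tnth x (lift ord0 i) = tnth ([tuple of behead x] : Rd R n) i.
  by rewrite [in LHS](tuple_eta x) tnthS.
congr (_ _); apply/seteqP; split=> x /=.
  move=> Ax; split=> [|i]; first exact: Ax.
  by have := Ax (lift ord0 i); rewrite tnth_behead.
move=> [A0 AS] i; have [j ->|->//] := unliftP ord0 i.
by rewrite tnth_behead; exact: AS.
Qed.

End LebesgueMeasureRd.

Section Cubes.
Context {R : realType} {d : nat}.
Local Notation E := (Rd R d).
Local Notation mu := (lebesgueRd d).

(* A cube is given by its centre and its side length; half-open cubes are used
   throughout, so that dyadic cubes can partition R^d. *)
Definition cube := (Rd R d * {posnum R}%R)%type.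

Definition cube_box (c : E) (l : R) : set E :=
  [set x : E | forall i, (tnth c i : R) - l / 2 <= (tnth x i : R)
                         < (tnth c i : R) + l / 2].

Definition cube_set (Q : cube) : set E := cube_box Q.1 Q.2%:num.

Definition dilate (gamma : R) (Q : cube) : set E :=
  cube_box Q.1 (gamma * Q.2%:num).

Definition vol (A : set E) : R := fine (mu A).

Definition dyadic_system (D : set cube) :=
  exists2 Dk : int -> set cube, D = \bigcup_k Dk k &
    forall k : int,
      [/\ forall Q, Dk k Q -> Q.2%:num = 2 ^ (- k),
          partition (Dk k) cube_set setT &
          forall Q, Dk (k + 1) Q ->
            exists2 Q', Dk k Q' & cube_set Q `<=` cube_set Q'].

Definition sparse (delta : R) (S : set cube) :=
  exists2 EQ : cube -> set E, trivIset S EQ &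
    forall Q, S Q ->
      [/\ measurable (EQ Q), EQ Q `<=` cube_set Q &
          (delta%:E * mu (cube_set Q) <= mu (EQ Q))%E].

Definition average (Q : cube) (f : E -> \bar R) : \bar R :=
  ((vol (cube_set Q))^-1%:E * \int[mu]_(x in cube_set Q) f x)%E.

(* At [s = t] the two expressions agree by Tonelli's theorem. *)
Definition Lmin (s t : R) (Q : cube) (Phi : E -> E -> R) : \bar R :=
  if s <= t then
    (average Q (fun y =>
       average Q (fun x => (`|Phi x y| `^ s)%:E) `^ (t / s)) `^ t^-1)%E
  else
    (average Q (fun x =>
       average Q (fun y => (`|Phi x y| `^ t)%:E) `^ (s / t)) `^ s^-1)%E.

(* The constant A_{s,t}. *)
Definition sup_Lmin n (a b : 'I_n -> E -> R) (s t : R) : \bar R :=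
  ereal_sup [set Lmin s t Q (fun x y => \sum_(i < n) a i x * b i y) | Q in setT].

End Cubes.
Arguments cube : clear implicits.

Section FunctionSpaces.
Context {R : realType} {d : nat}.
Local Notation E := (Rd R d).
Local Notation mu := (lebesgueRd d).
Implicit Types (V F G : set (E -> R)) (f g : E -> R).

(* Tuples carry no topology, so compactness is tested in ['rV[R]_d]. *)
Definition compactRd (K : set E) :=
  compact ((fun x : E => \row_i (tnth x i : R)) @` K).

Definition Lloc1 f :=
  measurable_fun setT f /\
  forall K, compactRd K -> (\int[mu]_(x in K) `|f x|%:E < +oo)%E.

Definition Linftyc : set (E -> R) :=
  [set f : E -> R | [/\ measurable_fun setT f, exists M : R, forall x, `|f x| <= M &
    exists2 K, compactRd K & forall x, ~ K x -> f x = 0]].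

Definition subspace V :=
  V (cst 0) /\ forall (c : R) f g, V f -> V g -> V (c \*o f \+ g).

Definition linear_on V (phi : (E -> R) -> R) :=
  forall (c : R) f g, V f -> V g -> phi (c \*o f \+ g) = c * phi f + phi g.

Definition function_space F :=
  [/\ F `<=` [set f : E -> R | measurable_fun setT f], subspace F & Linftyc `<=` F].

(* [T f] only matters for [f] in [F], and is a linear functional on [G]; the
   form of [T] is then [T] itself, with [<T f, g> = T f g]. *)
Definition operator_to_dual F G (T : (E -> R) -> (E -> R) -> R) :=
  (forall f, F f -> linear_on G (T f)) /\
  (forall g, G g -> linear_on F (T ^~ g)).

(* Functions are not identified when they agree a.e., hence [snorm] is only a
   seminorm; this does not affect dual balls. *)
Record seminormed_space := SeminormedSpace {
  carrier : set (E -> R) ;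
  snorm : (E -> R) -> \bar R }.

(* L^p(Q) with the normalised norm; [f] stands for its restriction to [Q]. *)
Definition normalizedL (p : R) (Q : set E) : seminormed_space := {|
  carrier := [set f | (f \_ Q) \in Lfun mu p%:E] ;
  snorm := fun f =>
    ((vol Q `^ (- p^-1))%:E * 'N[mu]_(p%:E)[EFin \o (f \_ Q)])%E |}.

Definition dual_ball (X : seminormed_space) : set ((E -> R) -> R) :=
  [set phi | linear_on (carrier X) phi /\
    forall f, carrier X f -> (`|phi f|%:E <= snorm X f)%E].

Definition convex_body (X : seminormed_space) n (f : 'I_n -> E -> R) :
    set ('I_n -> R) :=
  [set (fun i => phi (f i)) | phi in dual_ball X].

(* The endpoint [r] of the interval [A . B = [-r, r]]. *)
Definition body_dot n (A B : set ('I_n -> R)) : \bar R :=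
  ereal_sup [set (\sum_(i < n) u i * v i)%:E | u in A & v in B].

Definition convex_body_domination (D : set (cube R d))
    (X Y : cube R d -> seminormed_space) F G
    (tau : (E -> R) -> (E -> R) -> R) :=
  (forall Q, D Q -> F `<=` carrier (X Q) /\ G `<=` carrier (Y Q)) /\
  forall n, exists C delta : R, [/\ 0 <= C, 0 < delta &
    forall f g : 'I_n -> E -> R, (forall i, F (f i)) -> (forall i, G (g i)) ->
    exists S : set (cube R d), [/\ S `<=` D, sparse delta S &
      (`|\sum_(i < n) tau (f i) (g i)|%:E <=
       C%:E * \esum_(Q in S)
         (mu (cube_set Q) *
          body_dot (convex_body (X Q) f) (convex_body (Y Q) g)))%E]].

Definition conjugate_exponent (p : R) : R := p / (p - 1).

(* The space F_b. *)
Definition multiplier_domain F n (b : 'I_n -> E -> R) : set (E -> R) :=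
  [set f | F f /\ forall i, F (b i \* f)].

Definition multiplied_form (T : (E -> R) -> (E -> R) -> R) n
    (a b : 'I_n -> E -> R) f g : R :=
  \sum_(i < n) T (b i \* f) (a i \* g).

Definition Lp_part V (p : R) : set (E -> R) :=
  [set f | V f /\ f \in Lfun mu p%:E].

Definition dense_in_Lp (p : R) V :=
  forall f, f \in Lfun mu p%:E -> forall e : R, 0 < e ->
    exists2 h, V h & ('N[mu]_(p%:E)[EFin \o (f \- h)%R] < e%:E)%E.

(* The two density clauses are what makes the bound on the form determine an
   operator on L^p. *)
Definition extends_boundedly F G T n (a b : 'I_n -> E -> R) (p : R) :=
  let p' := conjugate_exponent p in
  let Fb := Lp_part (multiplier_domain F b) p in
  let Ga := Lp_part (multiplier_domain G a) p' in
  [/\ dense_in_Lp p Fb, dense_in_Lp p' Ga &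
    exists C : R, forall f g, Fb f -> Ga g ->
      (`|multiplied_form T a b f g|%:E <=
       C%:E * 'N[mu]_(p%:E)[EFin \o f] * 'N[mu]_(p'%:E)[EFin \o g])%E].

End FunctionSpaces.

(* Main.v *)
Require Import Defs.
From mathcomp Require Import all_boot all_order all_algebra.
From mathcomp Require Import all_classical all_reals all_analysis.
From mathcomp Require Import measurable_realfun ring lra.
Set Implicit Arguments.
Unset Strict Implicit.
Unset Printing Implicit Defensive.
Import Order.TTheory GRing.Theory Num.Theory.
Import numFieldNormedType.Exports.
Local Open Scope classical_set_scope.
Local Open Scope ring_scope.

(* Two applications of Hoelder's inequality bound the pairing of the convex
   bodies over a cube [Q] by A_{s,t} <|f|^t'>^(1/t') <|g|^s'>^(1/s'), where the
   averages are over the dilate of [Q]; no representation of the dual balls is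
   needed, since a functional is only evaluated on finite linear combinations.
   As t' < p and s' < p', the sum over a finite sparse family is then controlled
   by Young's inequality and the embedding
   sum |Q| <h>_{gamma Q}^q <= C int h^q  (q > 1),
   applied to h = |f|^t', q = p/t' and to h = |g|^s', q = p'/s'. The embedding is
   derived, without the maximal function, from the weak-type bound
   w sum |Q| <= C int_{U gamma Q} h for cubes with averages at least w, by
   summation by parts over the cubes ordered by their averages. *)

(** * Half-open cubes: measurability, volume and dilates *)

Section CubeGeometry.
Context {R : realType} {d : nat}.
Local Notation E := (Rd R d).
Local Notation mu := (lebesgueRd d).
Implicit Types (c : E) (r : R) (P Q : cube R d).

Lemma cube_boxE c r : cube_box c r =
  [set x : E | forall i, `[(tnth c i : R) - r / 2, (tnth c i : R) + r / 2[%classic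
    (tnth x i : R)].
Proof. by apply/seteqP; split => x /= xP i; have := xP i; rewrite in_itv/=. Qed.

Lemma measurable_cube_box c r : measurable (cube_box c r).
Proof.
rewrite cube_boxE; apply: (@measurable_boxRd R d
  (fun i => `[(tnth c i : R) - r / 2, (tnth c i : R) + r / 2[%classic)) => i.
exact: measurable_itv.
Qed.

Lemma lebesgueRd_cube_box c r : 0 <= r -> mu (cube_box c r) = (r ^+ d)%:E.
Proof.
move=> r0; rewrite cube_boxE (@lebesgueRd_box R d
  (fun i => `[(tnth c i : R) - r / 2, (tnth c i : R) + r / 2[%classic)); last first.
  by move=> i; exact: measurable_itv.
rewrite (eq_bigr (fun=> r%:E)); last first.
  move=> i _; rewrite lebesgue_measure_itv/= lte_fin; case: ifPn => [_|].
    by rewrite -EFinB; congr EFin; lra.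
  by rewrite -leNgt => rle; congr EFin; lra.
by rewrite prodEFin big_const_ord iter_mulr_1.
Qed.

(** Coordinatewise, a point of the first box is within [r1] of the common point [z], which is within
    [r2 / 2] of [c2]; and [r1 + r2 / 2] is at most [3 * r2 / 2]. *)
Lemma cube_box_sub_triple c1 c2 r1 r2 : r1 <= r2 ->
  cube_box c1 r1 `&` cube_box c2 r2 !=set0 -> cube_box c1 r1 `<=` cube_box c2 (3 * r2).
Proof.
move=> r12 [z [z1 z2]] x xP i.
have /andP[x1 x2] := xP i; have /andP[z11 z12] := z1 i.
have /andP[z21 z22] := z2 i; apply/andP; split; lra.
Qed.

Lemma cube_sub_dilate gamma Q : 1 <= gamma -> cube_set Q `<=` dilate gamma Q.
Proof.
move=> g1 x xP i; have /andP[x1 x2] := xP i.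
have h : Q.2%:num <= gamma * Q.2%:num by rewrite ler_peMl.
by apply/andP; split; lra.
Qed.

Lemma lebesgueRd_cube Q : mu (cube_set Q) = (Q.2%:num ^+ d)%:E.
Proof. by rewrite lebesgueRd_cube_box. Qed.

Lemma lebesgueRd_dilate gamma Q : 0 <= gamma ->
  mu (dilate gamma Q) = (gamma ^+ d * Q.2%:num ^+ d)%:E.
Proof. by move=> g0; rewrite lebesgueRd_cube_box ?mulr_ge0// exprMn. Qed.

End CubeGeometry.

(** * Packing of sparse families and the weak-type bound *)

Lemma seq_argmin {R : realType} {T : eqType} (f : T -> R) (l : seq T) :
  l != [::] -> exists2 x, x \in l & forall y, y \in l -> f x <= f y.
Proof.
elim: l => // a [_ _|b l IH _].
  by exists a; rewrite ?mem_head// => y; rewrite inE => /eqP->.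
have [//|x xl xmin] := IH; have [ax|/ltW xa] := leP (f a) (f x).
  exists a; rewrite ?mem_head// => y; rewrite inE => /predU1P[->//|/xmin].
  exact: le_trans.
exists x => [|y]; first by rewrite inE xl orbT.
by rewrite inE => /predU1P[->|/xmin].
Qed.

Section Packing.
Context {R : realType} {d : nat}.
Local Notation E := (Rd R d).
Local Notation mu := (lebesgueRd d).
Implicit Types (P Q : cube R d) (S : set (cube R d)) (l : seq (cube R d)).

(** The disjoint sets [EQ Q] all lie in [B], and each has at least the fraction [delta] of the
    measure of its cube, so additivity of [mu] suffices. *)
Lemma sparse_packing delta S l (B : set E) : sparse delta S ->
  uniq l -> (forall Q, Q \in l -> S Q) ->
  measurable B -> (forall Q, Q \in l -> cube_set Q `<=` B) ->
  (delta%:E * (\sum_(Q <- l) Q.2%:num ^+ d)%:E <= mu B)%E.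
Proof.
move=> [EQ tE EP] ul lS mB lB.
have /= mE Q : Q \in l -> measurable (EQ Q) by move=> /lS/EP[].
have tl : trivIset [set` l] EQ by apply: sub_trivIset tE => Q /= /lS.
pose U := \big[setU/set0]_(Q <- l) EQ Q.
have UE : mu U = (\sum_(Q <- l) mu (EQ Q))%E.
  rewrite /U -bigcup_seq measure_fin_bigcup//.
  exact/esym/fsbig_seq.
have mU : measurable U by rewrite /U -bigcup_seq; exact: fin_bigcup_measurable.
apply: (@le_trans _ _ (mu U)).
  rewrite UE -sumEFin ge0_sume_distrr; last by move=> Q _; rewrite lee_fin exprn_ge0.
  rewrite big_seq [leRHS]big_seq; apply: lee_sum => Q /lS SQ.
  by have [_ _] := EP _ SQ; rewrite lebesgueRd_cube.
apply: le_measure; rewrite ?inE// /U -bigcup_seq => x [Q /= lQ xQ].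
by apply: (lB _ lQ); have [_ + _] := EP _ (lS _ lQ); exact.
Qed.

Local Notation dil g l := (\big[setU/set0]_(Q <- l) dilate g Q).

(* Remove the largest cube [P] together with all cubes whose dilate meets the
   dilate of [P]: these are contained in the threefold dilate of [P]. *)
Lemma sparse_weak_type gamma delta S (h : E -> \bar R) (w : R) l :
  1 <= gamma -> 0 < delta -> 0 <= w -> sparse delta S ->
  measurable_fun setT h -> (forall x, 0 <= h x)%E ->
  uniq l -> (forall Q, Q \in l -> S Q) ->
  (forall Q, Q \in l ->
    (w%:E * mu (dilate gamma Q) <= \int[mu]_(x in dilate gamma Q) h x)%E) ->
  ((delta * w * \sum_(Q <- l) Q.2%:num ^+ d)%:E <=
    (3 ^+ d)%:E * \int[mu]_(x in dil gamma l) h x)%E.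
Proof.
move=> g1 d0 w0 sS mh h0.
have [m] := ubnP (size l); elim: m l => // m IH [|P0 l0] lm ul lS lw.
  rewrite !big_nil mulr0 mule_ge0 ?lee_fin ?exprn_ge0//.
  by rewrite integral_set0.
suff H : forall l, l != [::] -> (size l < m.+1)%N -> uniq l ->
    (forall Q, Q \in l -> S Q) ->
    (forall Q, Q \in l -> (w%:E * mu (dilate gamma Q) <=
      \int[mu]_(x in dilate gamma Q) h x)%E) ->
    ((delta * w * \sum_(Q <- l) Q.2%:num ^+ d)%:E <=
      (3 ^+ d)%:E * \int[mu]_(x in dil gamma l) h x)%E by apply: H.
move=> {P0 l0 lm ul lS lw} l l_neq0 lm ul lS lw.
have g0 : 0 <= gamma by apply: le_trans g1.
(* A largest cube, found as a minimiser of the negated side length. *)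
have [P lP Pmax] : exists2 P, P \in l & forall Q, Q \in l -> - P.2%:num <= - Q.2%:num.
  exact: (seq_argmin (fun Q : cube R d => - Q.2%:num)).
pose meet Q := `[< dilate gamma Q `&` dilate gamma P !=set0 >].
pose l1 := [seq Q <- l | meet Q]; pose l2 := [seq Q <- l | ~~ meet Q].
have l1l Q : Q \in l1 -> Q \in l by rewrite mem_filter => /andP[].
have l2l Q : Q \in l2 -> Q \in l by rewrite mem_filter => /andP[].
have mdil Q : measurable (dilate gamma Q) by exact: measurable_cube_box.
have mU (k : seq (cube R d)) : measurable (dil gamma k).
  by rewrite -bigcup_seq; exact: fin_bigcup_measurable.
have mhD A : measurable_fun A h by apply: measurable_funS mh.
have PP : P.1 \in dilate gamma P.
  rewrite inE => i; have : 0 < gamma * P.2%:num by rewrite mulr_gt0// (lt_le_trans _ g1).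
  move: (gamma * _) => r r0; apply/andP; split => /=; lra.
(* [P] belongs to [l1], since its dilate contains the centre [P.1]; hence [l2] is strictly shorter
   than [l]. *)
have l2m : (size l2 < m)%N.
  rewrite -ltnS (leq_trans _ lm)// ltnS size_filter -(count_predC meet l) addnC.
  rewrite -[X in (X < _)%N]addn0 ltn_add2l -has_count; apply/hasP; exists P => //.
  by apply/asboolP; exists P.1; rewrite setIid; exact/set_mem.
have IH2 := IH l2 l2m (filter_uniq _ ul) (fun Q h => lS _ (l2l _ h))
  (fun Q h => lw _ (l2l _ h)).
(* The cubes of [l1] pack into the threefold dilate of [dilate gamma P]. This costs the factor
   [3 ^+ d], and over [dilate gamma P] itself the average of [h] is at least [w]. *)
have H1 : ((delta * w * \sum_(Q <- l1) Q.2%:num ^+ d)%:E <=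
    (3 ^+ d)%:E * \int[mu]_(x in dilate gamma P) h x)%E.
  have := @sparse_packing delta S l1 (cube_box P.1 (3 * (gamma * P.2%:num))) sS
    (filter_uniq _ ul) (fun Q h => lS _ (l1l _ h)) (measurable_cube_box _ _).
  rewrite lebesgueRd_cube_box ?mulr_ge0// => H.
  apply: (@le_trans _ _ (w%:E * (3 ^+ d * (gamma * P.2%:num) ^+ d)%:E)%E).
    rewrite mulrAC mulrC EFinM lee_wpmul2l ?lee_fin//.
    rewrite -lee_fin EFinM -exprMn; apply: H => Q.
    rewrite mem_filter => /andP[/asboolP PQ lQ].
    move=> x /(cube_sub_dilate g1); move: x.
    apply: cube_box_sub_triple => //.
    by rewrite ler_wpM2l// -lerN2 Pmax.
  rewrite EFinM muleCA lee_wpmul2l ?lee_fin ?exprn_ge0//.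
  by rewrite exprMn -lebesgueRd_dilate// lw.
have -> : \sum_(Q <- l) Q.2%:num ^+ d =
    \sum_(Q <- l1) Q.2%:num ^+ d + \sum_(Q <- l2) Q.2%:num ^+ d.
  by rewrite !big_filter [LHS](bigID meet).
rewrite mulrDr EFinD.
apply: le_trans (leeD H1 IH2) _.
rewrite -ge0_muleDr; try by apply: integral_ge0.
rewrite lee_wpmul2l ?lee_fin ?exprn_ge0//.
(* By the choice of [l2] its dilates avoid that of [P], so the two integrals are over disjoint sets
   and the factor [3 ^+ d] does not accumulate. *)
rewrite -ge0_integral_setU//; last first.
  rewrite disj_set2E; apply/eqP; rewrite -bigcup_seq -subset0 => x [xP [Q /= + xQ]].
  by rewrite mem_filter => /andP[/negP + _]; apply; apply/asboolP; exists x.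
apply: ge0_subset_integral => //; first exact: measurableU.
rewrite -!bigcup_seq => x [xP|[Q /= /l2l lQ xQ]]; first by exists P.
by exists Q.
Qed.
End Packing.

(** * Real powers and Young's inequality *)

Lemma le_powR2 {R : realType} (r x y : R) :
  0 <= r -> 0 <= x -> x <= y -> x `^ r <= y `^ r.
Proof.
by move=> r0 x0 xy; apply: ge0_ler_powR; rewrite ?nnegrE//; apply: le_trans xy.
Qed.

Lemma conjugate_gt1 {R : realType} (q : R) : 1 < q -> 1 < conjugate_exponent q.
Proof. by move=> q1; rewrite /conjugate_exponent ltr_pdivlMr ?subr_gt0//; lra. Qed.

Lemma conjugateV {R : realType} (q : R) : 1 < q ->
  q^-1 + (conjugate_exponent q)^-1 = 1.
Proof. by move=> q1; rewrite /conjugate_exponent; field; rewrite ?subr_eq0; lra. Qed.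

(** The weights [1/q] and [1/q'] of the sharp form are below 1 and are dropped. *)
Lemma young_powR {R : realType} (q a b : R) : 1 < q -> 0 <= a -> 0 <= b ->
  a * b <= a `^ q + b `^ conjugate_exponent q.
Proof.
move=> q1 a0 b0; have q'1 := conjugate_gt1 q1.
apply: le_trans (conjugate_powR a0 b0 _ _ (conjugateV q1)) _; try lra.
by rewrite lerD// ler_pdivrMr ?ler_peMr ?powR_ge0//; lra.
Qed.

(** Young's inequality for the product of [w] and [w0^(q-1)], multiplied by [q'], with
    [q'/q = q' - 1]. It trades an increment of [w^q] for [w] times an increment of [w^(q-1)], and
    the factor [w] is what the weak-type bound can absorb. *)
Lemma powR_telescope {R : realType} (w0 w q : R) : 1 < q -> 0 <= w0 -> 0 <= w ->
  w `^ q - w0 `^ q <=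
    conjugate_exponent q * (w * (w `^ (q - 1) - w0 `^ (q - 1))).
Proof.
move=> q1 w00 w_ge0; have q'1 := conjugate_gt1 q1.
rewrite mulrBr mulr_powRB1//; last lra.
have := @conjugate_powR _ _ _ _ _ w_ge0 (powR_ge0 w0 (q - 1)) _ _ (conjugateV q1).
have -> : (w0 `^ (q - 1)) `^ conjugate_exponent q = w0 `^ q.
  by rewrite -powRrM /conjugate_exponent; congr powR; field; lra.
move=> /(_ ltac:(lra) ltac:(lra)).
move: (w0 `^ q) (w * _) (w `^ q) => A B W BWA.
have : conjugate_exponent q * B <=
    conjugate_exponent q * (W / q + A / conjugate_exponent q).
  by rewrite ler_wpM2l//; lra.
rewrite mulrBr [in X in _ <= X -> _]mulrDr [X in _ + X]mulrC divfK; last lra.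
have -> : conjugate_exponent q * (W / q) = conjugate_exponent q * W - W.
  by rewrite /conjugate_exponent; field; lra.
lra.
Qed.

Lemma measurable_fun_powR {d'} {T : measurableType d'} {R : realType} (D : set T)
    (f : T -> R) (r : R) :
  measurable_fun D f -> measurable_fun D (fun x => f x `^ r).
Proof. exact: measurableT_comp (measurable_powR r). Qed.

(** * The Carleson embedding for sparse families *)

Section Carleson.
Context {R : realType} {d : nat}.
Local Notation E := (Rd R d).
Local Notation mu := (lebesgueRd d).
Implicit Types (P Q : cube R d) (S : set (cube R d)) (l : seq (cube R d)).
Local Notation dil g l := (\big[setU/set0]_(Q <- l) dilate g Q).

Lemma sparse_telescope gamma delta S (h : E -> R) (v : cube R d -> R) (K : E -> R)
    (q w0 : R) l :
  1 <= gamma -> 0 < delta -> 1 < q -> 0 <= w0 -> sparse delta S ->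
  measurable_fun setT h -> (forall x, 0 <= h x) -> measurable_fun setT K ->
  uniq l -> (forall Q, Q \in l -> S Q) ->
  (forall Q, Q \in l -> w0 <= v Q) ->
  (forall Q, Q \in l ->
    ((v Q)%:E * mu (dilate gamma Q) <= \int[mu]_(x in dilate gamma Q) (h x)%:E)%E) ->
  (forall Q x, Q \in l -> dilate gamma Q x -> v Q `^ (q - 1) <= K x) ->
  ((delta * \sum_(Q <- l) Q.2%:num ^+ d * (v Q `^ q - w0 `^ q))%:E <=
    (3 ^+ d * conjugate_exponent q)%:E *
    \int[mu]_(x in dil gamma l) (h x * (K x - w0 `^ (q - 1)))%:E)%E.
Proof.
move=> g1 d0 q1 + sS mh h0 mK.
have q'1 := conjugate_gt1 q1.
have q'0 : 0 <= conjugate_exponent q by apply: ltW; apply: lt_trans q'1.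
have c0 : 0 <= 3 ^+ d * conjugate_exponent q.
  by apply: mulr_ge0; rewrite ?exprn_ge0.
have [m] := ubnP (size l); elim: m l w0 => // m IH l w0 lm w00 ul lS w0v lv vK.
have [->|l_neq0] := eqVneq l [::].
  by rewrite !big_nil mulr0 integral_set0 mule0.
have [P lP Pmin] := seq_argmin v l_neq0.
have g0 : 0 <= gamma by apply: le_trans g1.
have mdil Q : measurable (dilate gamma Q) by exact: measurable_cube_box.
have mU (k : seq (cube R d)) : measurable (dil gamma k).
  by rewrite -bigcup_seq; apply: fin_bigcup_measurable.
have mhK A c : measurable_fun A (fun x => (h x * (K x - c))%:E).
  apply: (@measurable_funS _ _ _ _ setT) => //; apply/measurable_EFinP.
  by apply: measurable_funM => //; apply: measurable_funB.
have mhA A : measurable_fun A (fun x => (h x)%:E).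
  by apply: (@measurable_funS _ _ _ _ setT) => //; apply/measurable_EFinP.
set w := v P; have w0w : w0 <= w by exact: w0v.
have w_ge0 : 0 <= w by exact: le_trans w0w.
pose l' := rem P l.
have l'l Q : Q \in l' -> Q \in l by move=> /mem_rem.
have hK0 x : dil gamma l x -> 0 <= h x * (K x - w `^ (q - 1)).
  rewrite -bigcup_seq => -[Q /= lQ xQ]; rewrite mulr_ge0// subr_ge0.
  by apply: le_trans (vK _ _ lQ xQ); apply: le_powR2 => [|//|]; [lra|exact: Pmin].
(* At level [w = v P] the term of [P] is zero and the induction hypothesis handles the others; the
   domain of integration may grow because the integrand is nonnegative on all the dilates. *)
have H1 : ((delta * \sum_(Q <- l) Q.2%:num ^+ d * (v Q `^ q - w `^ q))%:E <=
    (3 ^+ d * conjugate_exponent q)%:E *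
    \int[mu]_(x in dil gamma l) (h x * (K x - w `^ (q - 1)))%:E)%E.
  rewrite (big_rem _ lP)/= subrr mulr0 add0r.
  have l'm : (size l' < m)%N.
    by rewrite size_rem// -ltnS prednK// lt0n size_eq0.
  apply: le_trans (IH l' w l'm w_ge0 (rem_uniq _ ul) (fun Q h => lS _ (l'l _ h))
    (fun Q h => Pmin _ (l'l _ h)) (fun Q h => lv _ (l'l _ h))
    (fun Q x h => @vK _ x (l'l _ h))) _.
  rewrite lee_wpmul2l ?lee_fin//.
  apply: ge0_subset_integral => //.
  by rewrite -!bigcup_seq => x [Q /= /l'l lQ xQ]; exists Q.
pose D := w `^ (q - 1) - w0 `^ (q - 1).
have D0 : 0 <= D by rewrite subr_ge0 le_powR2//; lra.
(* Every cube of [l] has [v] at least [w], so the weak-type bound at height [w] pays for the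
   increment from [w0] to [w] on the whole list. *)
have H2 : ((delta * ((w `^ q - w0 `^ q) * \sum_(Q <- l) Q.2%:num ^+ d))%:E <=
    (3 ^+ d * conjugate_exponent q)%:E *
    \int[mu]_(x in dil gamma l) (h x * D)%:E)%E.
  apply: (@le_trans _ _ ((conjugate_exponent q * D)%:E *
      (delta * w * \sum_(Q <- l) Q.2%:num ^+ d)%:E)%E).
    rewrite -EFinM lee_fin.
    rewrite [leRHS](_ : _ = delta * ((conjugate_exponent q * (w * D)) *
      \sum_(Q <- l) Q.2%:num ^+ d)); last by ring.
    rewrite ler_wpM2l ?ler_wpM2r ?sumr_ge0// ?powR_telescope//; lra.
  under eq_integral do rewrite EFinM.
  rewrite ge0_integralZr//; try by move=> *; rewrite lee_fin.
  rewrite [leRHS](_ : _ = (conjugate_exponent q * D)%:E *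
      ((3 ^+ d)%:E * \int[mu]_(x in dil gamma l) (h x)%:E))%E; last first.
    move: (conjugate_exponent q) (3 ^+ d) (integral _ _ _) => c e I.
    rewrite [LHS]muleCA [RHS]muleA [RHS]muleC; congr (_ * _)%E.
    by rewrite -!EFinM; congr EFin; ring.
  rewrite lee_wpmul2l ?lee_fin//; first exact: mulr_ge0 q'0 D0.
  apply: sparse_weak_type g1 d0 w_ge0 sS _ _ ul lS _ => //.
  move=> Q lQ; apply: le_trans (lv _ lQ).
  by rewrite lee_wpmul2r// lee_fin Pmin.
rewrite (_ : \sum_(Q <- l) _ = \sum_(Q <- l) Q.2%:num ^+ d * (v Q `^ q - w `^ q) +
    (w `^ q - w0 `^ q) * \sum_(Q <- l) Q.2%:num ^+ d); last first.
  by rewrite mulr_sumr -big_split/=; apply: eq_bigr => Q _; ring.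
rewrite mulrDr EFinD; apply: le_trans (leeD H1 H2) _.
rewrite -ge0_muleDr; last 2 first.
- by apply: integral_ge0 => x xU; rewrite lee_fin hK0.
- by apply: integral_ge0 => x _; rewrite lee_fin mulr_ge0.
have hKe x : dil gamma l x -> (0 <= (h x * (K x - w `^ (q - 1)))%:E)%E.
  by move=> xU; rewrite lee_fin hK0.
have hDe x : dil gamma l x -> (0 <= (h x * D)%:E)%E.
  by move=> _; rewrite lee_fin mulr_ge0.
have mhD : measurable_fun (dil gamma l) (fun x => (h x * D)%:E).
  by apply/measurable_EFinP; apply: measurable_funM => //; exact/measurable_EFinP.
rewrite -(@ge0_integralD _ _ _ mu _ (mU l) _ _ hKe (mhK _ _) hDe mhD).
rewrite le_eqVlt; apply/predU1P; left; congr (_ * _)%E.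
by apply: eq_integral => x _; rewrite -EFinD -mulrDr /D; congr (_ * _)%:E; ring.
Qed.

(* The majorant [K] is chosen so that Young's inequality, applied to the
   telescoped bound, returns half of the left-hand side. *)
Lemma sparse_carleson gamma delta (q : R) :
  1 <= gamma -> 0 < delta -> 1 < q ->
  exists2 C : R, 0 <= C & forall S (h : E -> R) (v : cube R d -> R) l,
  sparse delta S -> measurable_fun setT h -> (forall x, 0 <= h x) ->
  uniq l -> (forall Q, Q \in l -> S Q) -> (forall Q, 0 <= v Q) ->
  (forall Q, Q \in l ->
    ((v Q)%:E * mu (dilate gamma Q) <= \int[mu]_(x in dilate gamma Q) (h x)%:E)%E) ->
  ((\sum_(Q <- l) Q.2%:num ^+ d * v Q `^ q)%:E <=
    C%:E * \int[mu]_x (h x `^ q)%:E)%E.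
Proof.
move=> g1 d0 q1; pose q' := conjugate_exponent q.
have q'1 : 1 < q' by exact: conjugate_gt1.
have q'0 : 0 <= q' by apply: ltW; apply: lt_trans q'1.
have q'_gt0 : 0 < q' by apply: lt_trans q'1.
have g0 : 0 <= gamma by apply: le_trans g1.
have G0 : 0 < gamma ^+ d by rewrite exprn_gt0// (lt_le_trans _ g1).
(* [M] is the constant of the telescoped bound. [L] is chosen so that the [q']-th power of [K / L]
   is [V / (2 gamma^d)], while the integral of [V] below is [gamma^d] times the left-hand side. *)
pose M := 3 ^+ d * q' / delta.
have M0 : 0 <= M by apply: divr_ge0; [apply: mulr_ge0; rewrite ?exprn_ge0|exact: ltW].
pose L := (2 * gamma ^+ d) `^ q'^-1.
have L0 : 0 < L by apply: powR_gt0; apply: mulr_gt0.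
exists (2 * (M * L) `^ q); first by rewrite mulr_ge0 ?powR_ge0.
move=> S h v l sS mh h0 ul lS v0 lv.
have mdil Q : measurable (dilate gamma Q) by exact: measurable_cube_box.
have mU : measurable (dil gamma l).
  by rewrite -bigcup_seq; apply: fin_bigcup_measurable.
pose V x := \sum_(Q <- l) v Q `^ q * \1_(dilate gamma Q) x.
have V0 x : 0 <= V x by rewrite sumr_ge0// => Q _; rewrite mulr_ge0 ?powR_ge0.
have mV : measurable_fun setT V.
  apply: measurable_sum => Q; apply: measurable_funM => //.
pose K x := V x `^ q'^-1.
have mK : measurable_fun setT K by apply: measurable_fun_powR.
have K0 x : 0 <= K x by exact: powR_ge0.
have vK Q x : Q \in l -> dilate gamma Q x -> v Q `^ (q - 1) <= K x.
  move=> lQ xQ; have -> : v Q `^ (q - 1) = (v Q `^ q) `^ q'^-1.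
    by rewrite -powRrM /q' /conjugate_exponent; congr powR; field; lra.
  apply: le_powR2; rewrite ?powR_ge0 ?invr_ge0//.
  rewrite /V (big_rem _ lQ)/= indicE mem_set// mulr1 lerDl sumr_ge0// => P _.
  by rewrite mulr_ge0 ?powR_ge0.
set X := \sum_(Q <- l) _.
have X0 : 0 <= X by rewrite sumr_ge0// => Q _; rewrite mulr_ge0 ?powR_ge0 ?exprn_ge0.
have H1 : ((delta * X)%:E <=
    (3 ^+ d * q')%:E * \int[mu]_(x in dil gamma l) (h x * K x)%:E)%E.
  (* The induction starts at level 0, where [0]^ q[and]0 [^ (q - 1)] both vanish because [q > 1]. *)
  have := sparse_telescope g1 d0 q1 (lexx 0) sS mh h0 mK ul lS (fun Q _ => v0 Q) lv vK.
  have q_gt0 : 0 < q by apply: lt_trans q1.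
  rewrite !powR0 ?subr_eq0 ?gt_eqF//.
  have -> : \sum_(Q <- l) Q.2%:num ^+ d * (v Q `^ q - 0) = X.
    by apply: eq_bigr => Q _; rewrite subr0.
  by under eq_integral do rewrite subr0.
have mhK : measurable_fun setT (fun x => (h x * K x)%:E).
  by apply/measurable_EFinP; exact: measurable_funM.
have mhq c : measurable_fun setT (fun x => (c * h x `^ q)%:E).
  apply/measurable_EFinP; apply: measurable_funM => //.
  exact: measurable_fun_powR.
have mcV c : measurable_fun setT (fun x => (c * V x)%:E).
  by apply/measurable_EFinP; exact: measurable_funM.
have G1_ge0 : 0 <= (2 * gamma ^+ d)^-1 by rewrite invr_ge0 mulr_ge0// ltW.
have H2 : (X%:E <= \int[mu]_x ((M * L) `^ q * h x `^ q)%:E +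
    \int[mu]_x ((2 * gamma ^+ d)^-1 * V x)%:E)%E.
  apply: (@le_trans _ _ (M%:E * \int[mu]_(x in dil gamma l) (h x * K x)%:E)%E).
    rewrite /M mulrC EFinM -muleA lee_pdivlMl// -EFinM.
  apply: (@le_trans _ _ (M%:E * \int[mu]_x (h x * K x)%:E)%E).
    rewrite lee_wpmul2l ?lee_fin//; apply: ge0_subset_integral => // x _.
    by rewrite lee_fin mulr_ge0.
  rewrite -ge0_integralZl//; last by move=> x _; rewrite lee_fin mulr_ge0.
  rewrite -ge0_integralD//; first last.
  - by move=> x _; rewrite lee_fin mulr_ge0.
  - by move=> x _; rewrite lee_fin mulr_ge0 ?powR_ge0.
  apply: ge0_le_integral => //.
  - by move=> x _; rewrite -EFinM lee_fin mulr_ge0// mulr_ge0.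
  - exact: measurable_funeM.
  - exact: emeasurable_funD.
  move=> x _; rewrite -EFinM -EFinD lee_fin.
  have -> : M * (h x * K x) = (M * L * h x) * (K x / L) by field; rewrite gt_eqF.
  have ML0 : 0 <= M * L by rewrite mulr_ge0// ltW.
  have hx0 := h0 x; have := young_powR q1 (mulr_ge0 ML0 hx0) (divr_ge0 (K0 x) (ltW L0)).
  move=> /le_trans; apply; rewrite (powRM _ ML0 hx0) lerD2l -/q' powRM ?invr_ge0 ?(ltW L0)//.
  rewrite /K -powRrM mulVf ?gt_eqF// powRr1// mulrC ler_wpM2r//.
  rewrite -powR_inv1 ?(ltW L0)// /L -!powRrM mulrCA mulN1r.
  by rewrite mulVf ?gt_eqF// powR_inv1// mulr_ge0// ltW.
have H3 : (\int[mu]_x ((2 * gamma ^+ d)^-1 * V x)%:E = (X / 2)%:E)%E.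
  under eq_integral do rewrite mulr_sumr -sumEFin.
  rewrite ge0_integral_sum//; last 2 first.
  - move=> Q; apply/measurable_EFinP; apply: measurable_funM => //.
    exact: measurable_funM.
  - by move=> Q y _; rewrite lee_fin !mulr_ge0 ?powR_ge0.
  rewrite mulr_suml -sumEFin; apply: eq_bigr => Q _.
  under eq_integral do rewrite mulrA EFinM.
  rewrite ge0_integralZl//; last 2 first.
  - exact/measurable_EFinP.
  - by rewrite lee_fin mulr_ge0 ?powR_ge0.
  rewrite integral_indic// setIT.
  rewrite [X in (_ * X)%E](_ : _ = (gamma ^+ d * Q.2%:num ^+ d)%:E); last first.
    exact: lebesgueRd_dilate.
  rewrite -EFinM; congr EFin.
  by field; rewrite gt_eqF.
move: H2; rewrite H3.
under eq_integral do rewrite EFinM.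
rewrite ge0_integralZl//; last 3 first.
- by have := mhq 1; under eq_fun do rewrite mul1r.
- by move=> x _; rewrite lee_fin powR_ge0.
- by rewrite lee_fin powR_ge0.
(* [X] is a finite sum of reals, so [X / 2] can be absorbed on the left; this doubles the
   constant. *)
rewrite -leeBlDr// -EFinB (_ : X - X / 2 = 2^-1 * X); last by field.
by rewrite EFinM lee_pdivrMl// EFinM muleA.
Qed.

End Carleson.

(** * Hoelder's inequality for averages *)

Section ScaledHoelder.
Context {dT} {T : measurableType dT} {R : realType}.
Variables (mu : {measure set T -> \bar R}) (D : set T) (mD : measurable D).
Local Open Scope ereal_scope.

Lemma Lnorm_patch (p : R) (f : T -> R) : (0 < p)%R ->
  'N[mu]_(p%:E)[EFin \o (f \_ D)] =
    (\int[mu]_(x in D) (`|f x| `^ p)%:E) `^ p^-1.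
Proof.
move=> p0; rewrite unlock [in RHS]integral_mkcond; congr (_ `^ _).
apply: eq_integral => x _ /=; rewrite /patch; case: ifPn => // _.
by rewrite normr0 powR0// gt_eqF.
Qed.

(** The scalar splits as [c = c^(1/q) c^(1/q')]. With [c] the inverse volume of a cube this is the
    inequality for averages. *)
Lemma hoelder_scaled (c q : R) (f g : T -> R) : (0 < c)%R -> (1 < q)%R ->
  measurable_fun D f -> measurable_fun D g ->
  c%:E * \int[mu]_(x in D) (`|f x * g x|)%:E <=
    (c%:E * \int[mu]_(x in D) (`|f x| `^ q)%:E) `^ q^-1 *
    (c%:E * \int[mu]_(x in D) (`|g x| `^ conjugate_exponent q)%:E)
      `^ (conjugate_exponent q)^-1.
Proof.
move=> c0 q1 mf mg; have q'1 := conjugate_gt1 q1; have q'V := conjugateV q1.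
have q0 : (0 < q)%R by apply: lt_trans q1.
move: q'1 q'V; move: (conjugate_exponent q) => q' q'1 q'V.
have q'0 : (0 < q')%R by apply: lt_trans q'1.
have Ip0 (F : T -> R) p : 0 <= \int[mu]_(x in D) (`|F x| `^ p)%:E.
  by apply: integral_ge0 => x _; rewrite lee_fin powR_ge0.
rewrite !poweRM ?lee_fin ?(ltW c0)// muleACA -EFinM.
rewrite [X in _ <= X%:E * _](_ : _ = c); last first.
  by rewrite -powRD; [rewrite q'V powRr1// ltW//|rewrite (gt_eqF c0) implybT].
rewrite lee_wpmul2l ?lee_fin ?(ltW c0)//.
have mfD : measurable_fun setT (f \_ D) by apply/(measurable_restrictT _ mD).
have mgD : measurable_fun setT (g \_ D) by apply/(measurable_restrictT _ mD).
have := hoelder mu mfD mgD q0 q'0 q'V.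
rewrite !Lnorm_patch// Lnorm1; apply: le_trans.
rewrite integral_mkcond le_eqVlt; apply/predU1P; left; apply: eq_integral => x _.
by rewrite /patch/=; case: ifPn => _; rewrite ?mul0r ?normr0.
Qed.

(** Needed because an inner norm can be infinite at some points. Integrability of [H^q] makes [H]
    finite almost everywhere, so [fine \o H] can replace it. *)
Lemma hoelder_scaled_ereal (c q : R) (H : T -> \bar R) (g : T -> R) :
  (0 < c)%R -> (1 < q)%R ->
  measurable_fun D H -> (forall x, 0 <= H x) -> measurable_fun D g ->
  \int[mu]_(x in D) (H x `^ q) < +oo ->
  c%:E * \int[mu]_(x in D) (H x * `|g x|%:E) <=
    (c%:E * \int[mu]_(x in D) (H x `^ q)) `^ q^-1 *
    (c%:E * \int[mu]_(x in D) (`|g x| `^ conjugate_exponent q)%:E)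
      `^ (conjugate_exponent q)^-1.
Proof.
move=> c0 q1 mH H0 mg Hoo; have q0 : (0 < q)%R by apply: lt_trans q1.
have mHq : measurable_fun D (fun x => H x `^ q).
  exact: measurableT_comp (measurable_poweR q) mH.
have iH : mu.-integrable D (fun x => H x `^ q).
  apply/integrableP; split=> //.
  by under eq_integral do rewrite gee0_abs ?poweR_ge0//.
have aeH : {ae mu, forall x, D x -> H x = (fine (H x))%:E}.
  apply: filterS (integrable_ae mD iH) => x Hx Dx.
  rewrite fineK// ge0_fin_numE// (@lty_poweRy _ _ q) ?gt_eqF//.
  by rewrite -ge0_fin_numE ?poweR_ge0//; exact: Hx.
have mf : measurable_fun D (fine \o H) by exact: measurableT_comp.
have mEf : measurable_fun D (EFin \o (fine \o H)) by exact/measurable_EFinP.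
have f0 x : (0 <= fine (H x))%R by rewrite fine_ge0.
have := hoelder_scaled c0 q1 mf mg.
rewrite [X in _ -> X <= _](_ : _ =
    c%:E * \int[mu]_(x in D) `|fine (H x) * g x|%:E); last first.
  congr (_ * _); apply: ge0_ae_eq_integral => //.
  - apply: emeasurable_funM => //; apply/measurable_EFinP.
    exact: measurableT_comp.
  - apply/measurable_EFinP; apply: measurableT_comp => //.
    exact: measurable_funM.
  - by move=> x _; rewrite mule_ge0// lee_fin.
  - by apply: filterS aeH => x Hx Dx; rewrite [in LHS]Hx// normrM ger0_norm// EFinM.
rewrite [X in _ -> _ <= (_ * X) `^ _ * _](_ : _ =
    \int[mu]_(x in D) (`|fine (H x)| `^ q)%:E)//.
apply: ge0_ae_eq_integral => //.
- apply/measurable_EFinP; apply: measurable_fun_powR; exact: measurableT_comp.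
- by move=> x _; rewrite poweR_ge0.
- by apply: filterS aeH => x Hx Dx; rewrite [in LHS]Hx// ger0_norm.
Qed.

End ScaledHoelder.

(** * Pairings of convex bodies and mixed norms *)

Section ConvexBodies.
Context {R : realType} {d : nat}.
Local Notation E := (Rd R d).
Local Notation mu := (lebesgueRd d).
Implicit Types (Q : cube R d) (V F G : set (E -> R)) (f g : E -> R).

(** The dilate as a [cube] in its own right, so that it takes part in the supremum defining
    A_{s,t}. *)
Definition dilated_cube (gamma : {posnum R}) Q : cube R d :=
  (Q.1, (gamma%:num * Q.2%:num)%:pos).

Lemma vol_cube Q : vol (cube_set Q) = Q.2%:num ^+ d.
Proof. by rewrite /vol lebesgueRd_cube. Qed.

Lemma vol_cube_gt0 Q : 0 < vol (cube_set Q).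
Proof. by rewrite vol_cube exprn_gt0. Qed.

Lemma measurable_cube Q : measurable (cube_set Q).
Proof. exact: measurable_cube_box. Qed.

Lemma average_ge0 Q (f : E -> \bar R) : (forall x, 0 <= f x)%E -> (0 <= average Q f)%E.
Proof.
move=> f0; apply: mule_ge0; last by apply: integral_ge0.
by rewrite lee_fin invr_ge0 ltW// vol_cube_gt0.
Qed.

(** Tonelli's theorem for [Psi] times the indicator of the cube in the first variable. *)
Lemma measurable_average Q (Psi : E -> E -> \bar R) :
  measurable_fun setT (fun z : E * E => Psi z.1 z.2) ->
  (forall x y, 0 <= Psi x y)%E ->
  measurable_fun setT (fun y => average Q (Psi ^~ y)).
Proof.
move=> mPsi Psi0; apply: measurable_funeM.
pose P (z : E * E) := (Psi z.1 z.2 * (\1_(cube_set Q) z.1)%:E)%E.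
have mP : measurable_fun setT P.
  apply: emeasurable_funM => //; apply/measurable_EFinP.
  exact: measurableT_comp (measurable_indic (measurable_cube Q)) measurable_fst.
have P0 z : (0 <= P z)%E by rewrite mule_ge0// lee_fin.
have := measurable_fun_fubini_tonelli_G (m1 := mu) P mP P0.
congr measurable_fun; apply/funext => y; rewrite /fubini_G [RHS]integral_mkcond.
apply: eq_integral => x _; rewrite /P /= indicE /patch.
by case: ifPn => _; rewrite ?mule1 ?mule0.
Qed.

Lemma subspace_sum F I (r : seq I) (c : I -> R) (u : I -> E -> R) :
  Defs.subspace F -> (forall i, F (u i)) -> F (fun x => \sum_(i <- r) c i * u i x).
Proof.
move=> [F0 FL] Fu; elim: r => [|i r IH].
  by under eq_fun do rewrite big_nil.
by under eq_fun do rewrite big_cons; exact: FL.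
Qed.

Lemma linear_on_sum F V (phi : (E -> R) -> R) I (r : seq I) (c : I -> R)
    (u : I -> E -> R) :
  Defs.subspace F -> F `<=` V -> linear_on V phi -> (forall i, F (u i)) ->
  phi (fun x => \sum_(i <- r) c i * u i x) = \sum_(i <- r) c i * phi (u i).
Proof.
move=> sF FV lphi Fu; have [F0 _] := sF; elim: r => [|i r IH].
  under eq_fun do rewrite big_nil; rewrite big_nil.
  (* The value at the zero function equals twice itself, hence is 0. *)
  have := lphi 1 _ _ (FV _ F0) (FV _ F0).
  rewrite (_ : _ \+ _ = cst 0); last by apply/funext => x /=; rewrite mulr0 addr0.
  by rewrite mul1r => /(congr1 (fun z => z - phi (cst 0))); rewrite subrr addrK.
under eq_fun do rewrite big_cons; rewrite big_cons -IH.
by apply: lphi; apply: FV; [exact: Fu|apply: (@subspace_sum F I r c u)].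
Qed.

Lemma dual_ball_le Q (phi : (E -> R) -> R) f :
  dual_ball (normalizedL 1 (cube_set Q)) phi ->
  carrier (normalizedL 1 (cube_set Q)) f ->
  (`|phi f|%:E <= average Q (fun x => `|f x|%:E))%E.
Proof.
move=> [_ /(_ f)] /[apply] /le_trans; apply.
rewrite /snorm/= Lnorm_patch//.
rewrite invr1 powRN powRr1 ?(ltW (vol_cube_gt0 _))// poweRe1; last first.
  by apply: integral_ge0 => x _; rewrite lee_fin powR_ge0.
by under eq_integral do rewrite powRr1//.
Qed.

(* The pairing is evaluated by applying first [phi], then for each fixed point
   [y] the functional [psi] to [sum_i (b_i y) a_i g]. *)
Lemma convex_body_pairing_le F G n (a b : 'I_n -> E -> R) Q phi psi f g :
  function_space F -> function_space G ->
  F `<=` carrier (normalizedL 1 (cube_set Q)) ->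
  G `<=` carrier (normalizedL 1 (cube_set Q)) ->
  dual_ball (normalizedL 1 (cube_set Q)) phi ->
  dual_ball (normalizedL 1 (cube_set Q)) psi ->
  (forall i, measurable_fun setT (a i)) -> (forall i, measurable_fun setT (b i)) ->
  measurable_fun setT f -> measurable_fun setT g ->
  (forall i, F (b i \* f)) -> (forall i, G (a i \* g)) ->
  ((`|\sum_(i < n) phi (b i \* f)%R * psi (a i \* g)%R|)%:E <=
   average Q (fun y => average Q (fun x => `|(\sum_(i < n) a i x * b i y) * g x|%:E)
     * `|f y|%:E))%E.
Proof.
move=> [Fm sF _] [Gm sG _] FX GX phiX psiX ma mb mf mg Fbf Gag.
pose h y := \sum_(i < n) psi (a i \* g) * (b i \* f) y.
have Fh : F h by exact: subspace_sum.
have -> : \sum_(i < n) phi (b i \* f) * psi (a i \* g) = phi h.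
  rewrite (linear_on_sum _ _ sF FX phiX.1 Fbf); apply: eq_bigr => i _; exact: mulrC.
apply: le_trans (dual_ball_le phiX (FX _ Fh)) _.
rewrite lee_wpmul2l ?lee_fin ?invr_ge0 ?(ltW (vol_cube_gt0 _))//.
apply: ge0_le_integral => //.
- exact: measurable_cube.
- apply: (@measurable_funS _ _ _ _ setT) => //; apply/measurable_EFinP.
  by apply: measurableT_comp => //; exact: Fm.
- apply: (@measurable_funS _ _ _ _ setT) => //; apply: emeasurable_funM.
    apply: measurable_average => //; apply/measurable_EFinP.
    apply: measurableT_comp => //; apply: measurable_funM.
      apply: measurable_sum => i; apply: measurable_funM;
        exact: measurableT_comp.
    exact: measurableT_comp.
  by apply/measurable_EFinP; exact: measurableT_comp.
move=> y _; pose k x := \sum_(i < n) b i y * (a i \* g) x.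
have Gk : G k by exact: subspace_sum.
have -> : h y = psi k * f y.
  rewrite (linear_on_sum _ _ sG GX psiX.1 Gag) mulr_suml; apply: eq_bigr => i _ /=.
  by ring.
rewrite normrM EFinM lee_wpmul2r//.
apply: le_trans (dual_ball_le psiX (GX _ Gk)) _.
rewrite le_eqVlt; apply/predU1P; left; congr (_ * _)%E; apply: eq_integral => x _.
by rewrite /k mulr_suml; congr (`|_|%:E); apply: eq_bigr => i _ /=; ring.
Qed.

(** Hoelder in [x] with exponent [s] separates [g], then Hoelder in [y] with exponent [t] separates
    [f]. The kernel [Phi] is given only up to an equation so that the lemma also applies with the
    two variables exchanged. *)
Lemma convex_body_pairing_mixed_norm F G n (a b : 'I_n -> E -> R) (Phi : E -> E -> R)
    Q phi psi f g s t :
  (forall x y, Phi x y = \sum_(i < n) a i x * b i y) -> 1 < s -> 1 < t ->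
  function_space F -> function_space G ->
  F `<=` carrier (normalizedL 1 (cube_set Q)) ->
  G `<=` carrier (normalizedL 1 (cube_set Q)) ->
  dual_ball (normalizedL 1 (cube_set Q)) phi ->
  dual_ball (normalizedL 1 (cube_set Q)) psi ->
  (forall i, measurable_fun setT (a i)) -> (forall i, measurable_fun setT (b i)) ->
  measurable_fun setT f -> measurable_fun setT g ->
  (forall i, F (b i \* f)) -> (forall i, G (a i \* g)) ->
  let A := (average Q (fun y => average Q (fun x =>
    (`|Phi x y| `^ s)%:E) `^ (t / s)) `^ t^-1)%E in
  (A < +oo)%E ->
  ((`|\sum_(i < n) phi (b i \* f)%R * psi (a i \* g)%R|)%:E <=
   A * average Q (fun y => (`|f y| `^ conjugate_exponent t)%:E)
         `^ (conjugate_exponent t)^-1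
     * average Q (fun x => (`|g x| `^ conjugate_exponent s)%:E)
         `^ (conjugate_exponent s)^-1)%E.
Proof.
move=> PhiE; have {PhiE} -> : Phi = fun x y => \sum_(i < n) a i x * b i y.
  by apply/funext => x; apply/funext => y.
move=> s1 t1 sF sG FX GX phiX psiX ma mb mf mg Fbf Gag A Aoo.
apply: le_trans (convex_body_pairing_le sF sG FX GX phiX psiX ma mb mf mg Fbf Gag) _.
have s0 : 0 < s by apply: lt_trans s1.
have t0 : 0 < t by apply: lt_trans t1.
pose c := (vol (cube_set Q))^-1; have c0 : 0 < c by rewrite invr_gt0 vol_cube_gt0.
pose Ng := (average Q (fun x => (`|g x| `^ conjugate_exponent s)%:E)
         `^ (conjugate_exponent s)^-1)%E.
pose H y := (average Q (fun x => (`|\sum_(i < n) a i x * b i y| `^ s)%:E) `^ s^-1)%E.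
have mPhi : measurable_fun setT (fun z : E * E => \sum_(i < n) a i z.1 * b i z.2).
  apply: measurable_sum => i; apply: measurable_funM; exact: measurableT_comp.
have mH : measurable_fun setT H.
  apply: measurableT_comp (measurable_poweR _) _.
  apply: measurable_average; last by move=> x y; rewrite lee_fin powR_ge0.
  apply/measurable_EFinP; apply: measurable_fun_powR; exact: measurableT_comp.
have H0 y : (0 <= H y)%E by exact: poweR_ge0.
have Ng0 : (0 <= Ng)%E by exact: poweR_ge0.
have mcube := measurable_cube Q.
have mfabs : measurable_fun setT (fun y => `|f y|%:E).
  by apply/measurable_EFinP; exact: measurableT_comp.
have mHf : measurable_fun setT (fun y => H y * `|f y|%:E)%E.
  exact: emeasurable_funM.
(* Inner Hoelder at each fixed [y]; the factor [Ng] does not depend on [y]. *)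
apply: (@le_trans _ _ (average Q (fun y => Ng * (H y * `|f y|%:E)))%E).
  rewrite lee_wpmul2l ?lee_fin ?(ltW c0)//.
  apply: ge0_le_integral => //.
  - move=> y _; rewrite mule_ge0 ?lee_fin//; apply: average_ge0 => x.
    by rewrite lee_fin.
  - apply: (@measurable_funS _ _ _ _ setT) => //; apply: emeasurable_funM => //.
    apply: measurable_average => //; apply/measurable_EFinP.
    apply: measurableT_comp => //; apply: measurable_funM => //.
    exact: measurableT_comp.
  - apply: (@measurable_funS _ _ _ _ setT) => //; exact: measurable_funeM.
  move=> y _; rewrite muleA lee_wpmul2r ?lee_fin// muleC.
  apply: hoelder_scaled => //; apply: (@measurable_funS _ _ _ _ setT) => //.
  by apply: measurable_sum => i; apply: measurable_funM.
have HtE : (\int[mu]_(y in cube_set Q) (H y `^ t) =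
    \int[mu]_(y in cube_set Q)
      average Q (fun x => (`|\sum_(i < n) a i x * b i y| `^ s)%:E) `^ (t / s))%E.
  by apply: eq_integral => y _; rewrite /H -poweRrM mulrC.
rewrite {1}/average ge0_integralZl//; last 2 first.
- by apply: (@measurable_funS _ _ _ _ setT).
- by move=> y _; rewrite mule_ge0.
rewrite muleCA muleC lee_wpmul2r//.
apply: le_trans (hoelder_scaled_ereal _ c0 t1 _ H0 _ _) _ => //.
- exact: (@measurable_funS _ _ _ _ setT).
- exact: (@measurable_funS _ _ _ _ setT).
(* Finiteness of the mixed norm is what makes [H^t] integrable over the cube. *)
- rewrite HtE; have := Aoo; rewrite /A => /lty_poweRy -/(_ ltac:(rewrite invr_eq0 gt_eqF//)).
  rewrite /average -/c => h; rewrite ltNge leye_eq; apply/negP => /eqP hoo.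
  by move: h; rewrite hoo gt0_muley ?lte_fin.
by rewrite HtE.
Qed.

End ConvexBodies.

(** * Density of the domains of the form *)

Section Density.
Context {R : realType} {d : nat}.
Local Notation E := (Rd R d).
Local Notation mu := (lebesgueRd d).
Implicit Types (F : set (E -> R)) (f : E -> R).

Lemma LfunP_Lnorm (p : \bar R) f :
  f \in Lfun mu p <-> measurable_fun setT f /\ ('N[mu]_p[EFin \o f] < +oo)%E.
Proof.
rewrite inE; split=> [/andP[]|[mf Nf]].
  by rewrite !inE/= => mf Nf; split => //; exact: mf.
by apply/andP; split; rewrite inE.
Qed.

Lemma compactRd_box (k : R) : compactRd [set x : E | forall i, `|tnth x i : R| <= k].
Proof.
rewrite /compactRd (_ : _ @` _ =
    [set v : 'rV[R]_d | forall i, `[-k, k]%classic (v ord0 i)]).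
  by apply: (@rV_compact R _ (fun=> `[-k, k]%classic)) => i; exact: segment_compact.
apply/seteqP; split => [_ [x xk <-] i|v vk] /=.
  by rewrite mxE in_itv/= -ler_norml.
exists [tuple (v ord0 i : measurableTypeR R) | i < d] => /=.
  by move=> i; rewrite tnth_mktuple; have := vk i; rewrite /= in_itv/= -ler_norml.
by apply/rowP => i; rewrite mxE tnth_mktuple.
Qed.

(** Cut [f] off to the set where the coordinates, [f] and all [b j] are controlled by [k]. The
    truncation and its products with the [b j] are then bounded with compact support, hence in [F],
    and dominated convergence gives convergence in L^p. *)
Lemma dense_multiplier_domain F n (b : 'I_n -> E -> R) (p : R) :
  function_space F -> (forall i, measurable_fun setT (b i)) -> 1 < p ->
  dense_in_Lp p (Lp_part (multiplier_domain F b) p).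
Proof.
move=> [_ _ LF] mb p1 f /LfunP_Lnorm[mf Nf] e e0.
have p0 : 0 < p by apply: lt_trans p1.
pose m (x : E) : R := \sum_(i < d) `|tnth x i : R| + `|f x| + \sum_(j < n) `|b j x|.
have mm : measurable_fun setT m.
  apply: measurable_funD; first apply: measurable_funD.
  - apply: measurable_sum => i; apply: measurableT_comp => //; exact: measurable_tnth.
  - exact: measurableT_comp.
  - by apply: measurable_sum => i; apply: measurableT_comp.
have S1 x : 0 <= \sum_(i < d) `|tnth x i : R| by rewrite sumr_ge0.
have S2 x : 0 <= \sum_(j < n) `|b j x| by rewrite sumr_ge0.
have mtnth x i : `|tnth x i : R| <= m x.
  rewrite /m (bigD1 i)//= -!addrA lerDl !addr_ge0// sumr_ge0//.
have mfx x : `|f x| <= m x by rewrite /m -addrA addrCA lerDl addr_ge0.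
have mbx x j : `|b j x| <= m x.
  rewrite /m [X in _ + X](bigD1 j)//= addrCA lerDl !addr_ge0// sumr_ge0//.
pose B (k : nat) := [set x : E | m x <= k%:R].
have mB k : measurable (B k).
  have -> : B k = setT `&` m @^-1` `]-oo, k%:R].
    by apply/seteqP; split => x /=; rewrite in_itv/=; [split|case].
  by apply: mm => //.
pose h (k : nat) x := f x * \1_(B k) x.
have mh k : measurable_fun setT (h k).
  by apply: measurable_funM => //; exact: measurable_indic.
have Bh k x : ~ B k x -> h k x = 0.
  by move=> nB; rewrite /h indicE memNset// mulr0.
have hB k x : B k x -> h k x = f x.
  by move=> xB; rewrite /h indicE mem_set// mulr1.
have hLc k (u : E -> R) : measurable_fun setT u -> (forall x, `|u x| <= m x) ->
    Linftyc (u \* h k).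
  move=> mu_ um; split; first exact: measurable_funM.
    exists (k%:R * k%:R) => x; have [xB|xB] := pselect (B k x).
      rewrite /= normrM hB// ler_pM//; first exact: le_trans (um x) xB.
      exact: le_trans (mfx x) xB.
    by rewrite /= Bh// mulr0 normr0 mulr_ge0.
  exists [set x : E | forall i, `|tnth x i : R| <= k%:R]; first exact: compactRd_box.
  move=> x xK; rewrite /= Bh ?mulr0// => xB; apply: xK => i.
  exact: le_trans (mtnth x i) xB.
have Fh k : F (h k).
  apply: LF; split => //.
    exists k%:R => x; have [xB|xB] := pselect (B k x).
      by rewrite hB//; exact: le_trans (mfx x) xB.
    by rewrite Bh// normr0.
  exists [set x : E | forall i, `|tnth x i : R| <= k%:R]; first exact: compactRd_box.
  by move=> x xK; rewrite Bh// => xB; apply: xK => i; exact: le_trans (mtnth x i) xB.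
have Fbh k : multiplier_domain F b (h k) by split=> // i; apply: LF; exact: hLc.
have hf k x : `|h k x| <= `|f x|.
  have [xB|xB] := pselect (B k x); first by rewrite hB.
  by rewrite Bh// normr0.
have Nfoo : (\int[mu]_x (`|f x| `^ p)%:E < +oo)%E.
  by move: Nf; rewrite unlock => /lty_poweRy; apply; rewrite invr_eq0 gt_eqF.
have hLp k : h k \in Lfun mu p%:E.
  apply/LfunP_Lnorm; split => //; rewrite unlock; apply: poweR_lty.
  apply: le_lt_trans Nfoo; apply: ge0_le_integral => //.
  - by move=> x _; rewrite lee_fin powR_ge0.
  - apply/measurable_EFinP; apply: measurable_fun_powR; exact: measurableT_comp.
  - apply/measurable_EFinP; apply: measurable_fun_powR; exact: measurableT_comp.
  - by move=> x _; rewrite lee_fin le_powR2// ltW.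
pose D k x := (`|f x - h k x| `^ p)%:E.
have mD k : measurable_fun setT (D k).
  apply/measurable_EFinP; apply: measurable_fun_powR; apply: measurableT_comp => //.
  exact: measurable_funB.
have iF : mu.-integrable setT (fun x => (`|f x| `^ p)%:E).
  apply/integrableP; split.
    by apply/measurable_EFinP; apply: measurable_fun_powR; exact: measurableT_comp.
  by under eq_integral do rewrite gee0_abs ?lee_fin ?powR_ge0//.
(* At each point the truncation equals [f] as soon as [k] exceeds [m x], so the sequence is
   eventually 0. *)
have aecv : {ae mu, forall x, setT x -> D k x @[k --> \oo] --> (cst 0%E : E -> \bar R) x}.
  apply: aeW => x _; apply: cvg_near_cst; exists (Num.truncn (m x)).+1 => // k /= mk.
  rewrite /D hB ?subrr ?normr0 ?powR0 ?gt_eqF// /B/=.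
  apply: ltW; apply: lt_le_trans (truncnS_gt _) _.
  by rewrite ler_nat.
have aeb : {ae mu, forall x k, setT x -> (`|D k x| <= (`|f x| `^ p)%:E)%E}.
  apply: aeW => x k _; rewrite gee0_abs ?lee_fin ?powR_ge0//.
  apply: le_powR2 => //; first exact: ltW.
  have [xB|xB] := pselect (B k x); first by rewrite hB// subrr normr0.
  by rewrite Bh// subr0.
have [_ _] := @dominated_convergence _ _ _ mu setT measurableT D (cst 0%E)
  (fun x => (`|f x| `^ p)%:E) mD (measurable_cst _) aecv iF aeb.
rewrite integral0 => /fine_cvgP[finD /cvgrPdist_lt/(_ (e `^ p) (powR_gt0 _ e0)) Dlt].
near \oo => k.
exists (h k); first by split.
have Dk : (\int[mu]_x D k x < (e `^ p)%:E)%E.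
  have kfin : (\int[mu]_x D k x)%E \is a fin_num by near: k.
  rewrite -(fineK kfin) lte_fin; apply: le_lt_trans (ler_norm _) _.
  by rewrite -normrN -sub0r; near: k.
have -> : e%:E = ((e `^ p)%:E `^ p^-1)%E.
  by rewrite poweR_EFin -powRrM mulfV ?gt_eqF// powRr1// ltW.
rewrite unlock.
have ip0 : 0 < p^-1 by rewrite invr_gt0.
have I0 : (0 <= \int[mu]_x D k x)%E.
  by apply: integral_ge0 => x _; rewrite lee_fin powR_ge0.
move: Dk I0; rewrite /D/=.
case: (integral _ _ _) => //= r; rewrite !lte_fin !lee_fin => re r0.
by apply: gt0_ltr_powR => //; rewrite nnegrE// powR_ge0.
Unshelve. all: by end_near.
Qed.

End Density.

(** * Summation over the sparse family and the bound on the form *)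

Lemma sum_young {R : realType} {I : eqType} (l : seq I) (c u w : I -> R)
    (p X Y C1 C2 : R) :
  1 < p -> 0 <= X -> 0 <= Y ->
  (forall i, 0 < c i) -> (forall i, 0 <= u i) -> (forall i, 0 <= w i) ->
  \sum_(i <- l) c i * u i `^ p <= C1 * X `^ p ->
  \sum_(i <- l) c i * w i `^ conjugate_exponent p <= C2 * Y `^ conjugate_exponent p ->
  \sum_(i <- l) c i * (u i * w i) <= (C1 + C2) * (X * Y).
Proof.
move=> p1 X0 Y0 c0 u0 w0; have := conjugate_gt1 p1.
move: (@young_powR _ p) => yng; move: (conjugate_exponent p) yng => p' yng p'1 Hu Hw.
(* Degenerate case: if [X] or [Y] is 0, its bound forces all the terms to vanish, since the weights
   [c i] are positive. *)
have vanish (r C : R) (v : I -> R) : 1 < r -> (forall i, 0 <= v i) ->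
    \sum_(i <- l) c i * v i `^ r <= C * 0 `^ r -> forall i, i \in l -> v i = 0.
  move=> r1 v0; rewrite powR0; last by rewrite gt_eqF// (lt_trans _ r1).
  rewrite mulr0 => H i il.
  have : c i * v i `^ r <= 0.
    apply: le_trans H; rewrite (big_rem _ il)/= lerDl sumr_ge0// => j _.
    by rewrite mulr_ge0 ?powR_ge0// ltW.
  rewrite pmulr_rle0// => h; apply/eqP; rewrite eq_le v0 andbT leNgt; apply/negP => vi.
  by move: h; rewrite leNgt powR_gt0.
have [X00|Xn0] := eqVneq X 0.
  rewrite X00 in Hu; rewrite X00 mul0r mulr0 big_seq big1// => i il.
  by rewrite (vanish _ _ _ p1 u0 Hu)// mul0r mulr0.
have [Y00|Yn0] := eqVneq Y 0.
  rewrite Y00 in Hw; rewrite Y00 !mulr0 big_seq big1// => i il.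
  by rewrite (vanish _ _ _ p'1 w0 Hw)// !mulr0.
have Xp : 0 < X by rewrite lt_neqAle eq_sym Xn0.
have Yp : 0 < Y by rewrite lt_neqAle eq_sym Yn0.
(* Dividing by [X] and [Y] before applying Young's inequality turns its sum of powers into a bound
   by the product [X * Y]. *)
have norm (r C Z : R) (v : I -> R) : 0 < Z -> (forall i, 0 <= v i) ->
    \sum_(i <- l) c i * v i `^ r <= C * Z `^ r ->
    \sum_(i <- l) c i * (v i / Z) `^ r <= C.
  move=> Z0 v0 H; rewrite -(ler_pM2r (powR_gt0 r Z0)); apply: le_trans H.
  rewrite mulr_suml le_eqVlt; apply/predU1P; left; apply: eq_bigr => i _.
  by rewrite -mulrA -powRM ?divr_ge0 ?(ltW Z0)// divfK// gt_eqF.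
have Hu1 := norm _ _ _ _ Xp u0 Hu; have Hw1 := norm _ _ _ _ Yp w0 Hw.
rewrite -ler_pdivrMr ?mulr_gt0//; apply: le_trans (lerD Hu1 Hw1).
rewrite -big_split/= mulr_suml; apply: ler_sum => i _; rewrite -mulrDr -mulrA.
rewrite ler_wpM2l ?(ltW (c0 i))//.
have -> : u i * w i / (X * Y) = (u i / X) * (w i / Y) by field; rewrite Xn0 Yn0.
by apply: yng => //; exact: divr_ge0.
Qed.

Section Combination.
Context {R : realType} {d : nat}.
Local Notation E := (Rd R d).
Local Notation mu := (lebesgueRd d).
Implicit Types (Q : cube R d) (S : set (cube R d)) (f g : E -> R).

(** Real-valued, so that it can enter the sums above. An infinite average would be sent to 0 by
    [fine], hence the finiteness hypothesis of [power_meanE]. *)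
Definition power_mean (gamma : {posnum R}) (r : R) f Q : R :=
  fine (average (dilated_cube gamma Q) (fun x => (`|f x| `^ r)%:E)) `^ r^-1.

Lemma power_meanE gamma r f Q :
  average (dilated_cube gamma Q) (fun x => (`|f x| `^ r)%:E) \is a fin_num ->
  (power_mean gamma r f Q)%:E =
    (average (dilated_cube gamma Q) (fun x => (`|f x| `^ r)%:E) `^ r^-1)%E.
Proof. by move=> ffin; rewrite /power_mean -poweR_EFin fineK. Qed.

(** Pointwise [|f|^r] is at most [1 + |f|^p], and a cube has finite measure. *)
Lemma power_average_fin Q r p f : 1 < r -> r < p -> measurable_fun setT f ->
  (\int[mu]_x (`|f x| `^ p)%:E < +oo)%E ->
  average Q (fun x => (`|f x| `^ r)%:E) \is a fin_num.
Proof.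
move=> r1 rp mf fp.
have mr c : measurable_fun setT (fun x => (`|f x| `^ c)%:E).
  by apply/measurable_EFinP; apply: measurable_fun_powR; exact: measurableT_comp.
have mcube := measurable_cube Q.
rewrite /average fin_numM// ge0_fin_numE; last first.
  by apply: integral_ge0 => x _; rewrite lee_fin powR_ge0.
apply: (@le_lt_trans _ _ (\int[mu]_(x in cube_set Q) (1 + (`|f x| `^ p)%:E))%E).
  apply: ge0_le_integral => //.
  - by apply: (@measurable_funS _ _ _ _ setT).
  - apply: emeasurable_funD => //; by apply: (@measurable_funS _ _ _ _ setT).
  move=> x _; rewrite -EFinD lee_fin.
  have [f1|/ltW f1] := leP (`|f x|) 1.
    apply: (@le_trans _ _ 1); last by rewrite lerDl powR_ge0.
    have := @le_powR2 _ r `|f x| 1; rewrite powR1; apply => //; lra.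
  by apply: (@le_trans _ _ (`|f x| `^ p)); [apply: ler_powR => //; exact: ltW|rewrite lerDr].
rewrite ge0_integralD//; last first.
- by apply: (@measurable_funS _ _ _ _ setT).
have muQ : (mu (cube_set Q) < +oo)%E by rewrite lebesgueRd_cube ltry.
rewrite integral_cst// mul1e; apply: lte_add_pinfty; first exact: muQ.
apply: le_lt_trans fp; apply: ge0_subset_integral => //.
Qed.

(** The embedding for [h = |f|^r] with exponent [p / r], which exceeds 1 because [r < p]. The
    constant is fixed before the family and the function. *)
Lemma sparse_power_mean (gamma : {posnum R}) (delta r p : R) :
  1 <= gamma%:num -> 0 < delta -> 1 < r -> r < p ->
  exists2 C : R, 0 <= C & forall S f (l : seq (cube R d)), sparse delta S ->
  measurable_fun setT f -> ('N[mu]_(p%:E)[EFin \o f] < +oo)%E ->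
  uniq l -> (forall Q, Q \in l -> S Q) ->
  \sum_(Q <- l) Q.2%:num ^+ d * power_mean gamma r f Q `^ p <=
    C * fine ('N[mu]_(p%:E)[EFin \o f])%E `^ p.
Proof.
move=> g1 d0 r1 rp; have r0 : 0 < r by apply: lt_trans r1.
have p0 : 0 < p by apply: lt_trans rp.
have q1 : 1 < p / r by rewrite ltr_pdivlMr ?mul1r.
have [C C0 HC] := sparse_carleson (d := d) g1 d0 q1.
exists C => // S f l sS mf Nf ul lS.
pose h x := `|f x| `^ r.
pose v Q := fine (average (dilated_cube gamma Q) (fun x => (h x)%:E)).
have NE : ('N[mu]_(p%:E)[EFin \o f] = (\int[mu]_x (`|f x| `^ p)%:E) `^ p^-1)%E.
  by rewrite unlock.
have fp : (\int[mu]_x (`|f x| `^ p)%:E < +oo)%E.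
  by move: Nf; rewrite NE => /lty_poweRy; apply; rewrite invr_eq0 gt_eqF.
have fp0 : (0 <= \int[mu]_x (`|f x| `^ p)%:E)%E.
  by apply: integral_ge0 => x _; rewrite lee_fin powR_ge0.
have av0 Q : (0 <= average Q (fun x => (h x)%:E))%E.
  by apply: average_ge0 => x; rewrite lee_fin powR_ge0.
have v0 Q : 0 <= v Q by rewrite fine_ge0.
have mh : measurable_fun setT h.
  by apply: measurable_fun_powR; exact: measurableT_comp.
have := HC S h v l sS mh (fun x => powR_ge0 _ _) ul lS v0.
rewrite (_ : \sum_(Q <- l) _ = \sum_(Q <- l) Q.2%:num ^+ d * power_mean gamma r f Q `^ p).
  rewrite (_ : (\int[mu]_x (h x `^ (p / r))%:E)%E =
      (fine ('N[mu]_(p%:E)[EFin \o f])%E `^ p)%:E).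
    rewrite -EFinM lee_fin; apply => Q lQ.
    (* The averages meet the hypothesis of the embedding with equality. *)
    rewrite /v fineK; last exact: power_average_fin rp _ _.
    rewrite /average -/(cube_set (dilated_cube gamma Q)).
    rewrite (_ : mu (dilate _ _) = (vol (cube_set (dilated_cube gamma Q)))%:E).
      by rewrite muleAC -EFinM mulVf ?mul1e// gt_eqF// vol_cube_gt0.
    by rewrite vol_cube lebesgueRd_dilate//= exprMn.
  rewrite NE fine_poweR -powRrM mulVf ?(gt_eqF p0)// powRr1 ?(fine_ge0 fp0)//.
  have fpfin : (\int[mu]_x (`|f x| `^ p)%:E)%E \is a fin_num by rewrite ge0_fin_numE.
  rewrite (fineK fpfin).
  apply: eq_integral => x _; rewrite /h -powRrM; congr (_ `^ _)%:E.
  by rewrite mulrC divfK// gt_eqF.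
apply: eq_bigr => Q _; rewrite /power_mean -powRrM; congr (_ * _ `^ _).
by rewrite mulrC.
Qed.

Lemma body_dot_power_mean_le (gamma : {posnum R}) F G n (a b : 'I_n -> E -> R)
    (s t p : R) Q f g :
  1 < s -> 1 < t -> conjugate_exponent t < p -> p < s ->
  conjugate_exponent s < conjugate_exponent p ->
  function_space F -> function_space G ->
  F `<=` carrier (normalizedL 1 (dilate gamma%:num Q)) ->
  G `<=` carrier (normalizedL 1 (dilate gamma%:num Q)) ->
  (forall i, measurable_fun setT (a i)) -> (forall i, measurable_fun setT (b i)) ->
  (sup_Lmin a b s t < +oo)%E ->
  Lp_part (multiplier_domain F b) p f ->
  Lp_part (multiplier_domain G a) (conjugate_exponent p) g ->
  (body_dot (convex_body (normalizedL 1 (dilate gamma%:num Q)) (fun i => b i \* f)%R)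
            (convex_body (normalizedL 1 (dilate gamma%:num Q)) (fun i => a i \* g)%R) <=
    (fine (sup_Lmin a b s t) * (power_mean gamma (conjugate_exponent t) f Q *
      power_mean gamma (conjugate_exponent s) g Q))%:E)%E.
Proof.
move=> s1 t1 tp ps sp sF sG FX GX ma mb Aoo [[Ff Fbf] /LfunP_Lnorm[mf Nf]]
  [[Gg Gag] /LfunP_Lnorm[mg Ng]].
have s'1 := conjugate_gt1 s1; have t'1 := conjugate_gt1 t1.
have p0 : 0 < p by apply: lt_trans tp; apply: lt_trans t'1.
have p'0 : 0 < conjugate_exponent p by apply: lt_trans sp; apply: lt_trans s'1.
set P := dilated_cube gamma Q.
have Lfin (r : R) (h : E -> R) : 0 < r -> ('N[mu]_(r%:E)[EFin \o h] < +oo)%E ->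
    (\int[mu]_x (`|h x| `^ r)%:E < +oo)%E.
  by move=> r0; rewrite unlock => /lty_poweRy; apply; rewrite invr_eq0 gt_eqF.
have ff := power_average_fin P t'1 tp mf (Lfin _ _ p0 Nf).
have gf := power_average_fin P s'1 sp mg (Lfin _ _ p'0 Ng).
pose Phi x y := \sum_(i < n) a i x * b i y.
have PhiE x y : Phi x y = \sum_(i < n) a i x * b i y by [].
have PhiT y x : Phi x y = \sum_(i < n) b i y * a i x.
  by apply: eq_bigr => i _; rewrite mulrC.
pose L := Lmin s t P Phi.
have LA : (L <= sup_Lmin a b s t)%E by apply: ereal_sup_ubound; exists P.
have L0 : (0 <= L)%E by rewrite /L /Lmin; case: ifP => _; exact: poweR_ge0.
have A0 := le_trans L0 LA.
have Loo : (L < +oo)%E by exact: le_lt_trans LA Aoo.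
apply: ge_ereal_sup => _ [_ [phi phiX <-] [_ [psi psiX <-] <-]].
set A := sup_Lmin a b s t in LA A0 Aoo *.
have AE : (fine A)%:E = A by rewrite fineK// ge0_fin_numE.
have uE := power_meanE ff; have wE := power_meanE gf.
have EM (x y z : R) : (x * (y * z))%:E = (x%:E * (y%:E * z%:E))%E by [].
move: uE wE; move: (power_mean _ _ f Q) (power_mean _ _ g Q) => u w uE wE.
rewrite [leRHS]EM AE uE wE.
apply: (@le_trans _ _ (`|\sum_(i < n) phi (b i \* f) * psi (a i \* g)|%:E)).
  by rewrite lee_fin ler_norm.
apply: (@le_trans _ _ (L * (average P (fun y => (`|f y| `^ conjugate_exponent t)%:E)
         `^ (conjugate_exponent t)^-1
     * average P (fun x => (`|g x| `^ conjugate_exponent s)%:E)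
         `^ (conjugate_exponent s)^-1))%E); last first.
  by rewrite lee_wpmul2r// mule_ge0// poweR_ge0.
move: Loo; rewrite /L /Lmin; case: ifP => _ Loo.
  rewrite muleA.
  exact: (convex_body_pairing_mixed_norm (Q := P) PhiE s1 t1
    sF sG FX GX phiX psiX ma mb mf mg Fbf Gag Loo).
(* For [t < s] the inner norm is in [y]; the pairing is symmetric under exchanging [(a, g, psi, s)]
   with [(b, f, phi, t)]. *)
rewrite (_ : \sum_(i < n) _ = \sum_(i < n) psi (a i \* g) * phi (b i \* f)); last first.
  by apply: eq_bigr => i _; rewrite mulrC.
rewrite [leRHS]muleCA [leRHS]muleC.
exact: (convex_body_pairing_mixed_norm (Q := P) PhiT t1 s1
  sG sF GX FX psiX phiX mb ma mg mf Gag Fbf Loo).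
Qed.

Lemma multiplied_form_bounded (D : set (cube R d)) F G T (gamma : R) n
    (a b : 'I_n -> E -> R) (s t p : R) :
  function_space F -> function_space G -> 1 <= gamma ->
  convex_body_domination D
    (fun Q => normalizedL 1 (dilate gamma Q))
    (fun Q => normalizedL 1 (dilate gamma Q)) F G T ->
  (forall i, measurable_fun setT (a i)) -> (forall i, measurable_fun setT (b i)) ->
  1 < s -> 1 < t -> (sup_Lmin a b s t < +oo)%E ->
  conjugate_exponent t < p -> p < s ->
  exists C : R, forall f g, Lp_part (multiplier_domain F b) p f ->
    Lp_part (multiplier_domain G a) (conjugate_exponent p) g ->
    (`|multiplied_form T a b f g|%:E <=
      C%:E * 'N[mu]_(p%:E)[EFin \o f] *
      'N[mu]_((conjugate_exponent p)%:E)[EFin \o g])%E.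
Proof.
move=> sF sG g1 [FGX dom] ma mb s1 t1 Aoo tp ps.
have s'1 := conjugate_gt1 s1; have t'1 := conjugate_gt1 t1.
have p1 : 1 < p by exact: lt_trans tp.
(* Since [1/r' = 1 - 1/r], conjugation reverses [p < s]; this is the condition for the embedding on
   the side of [g]. *)
have sp : conjugate_exponent s < conjugate_exponent p.
  have HV r : 1 < r -> (conjugate_exponent r)^-1 = 1 - r^-1.
    by move=> /conjugateV <-; rewrite addrAC subrr add0r.
  have p'1 := conjugate_gt1 p1.
  rewrite -ltf_pV2 ?posrE ?(lt_trans ltr01)// !HV//.
  by rewrite ltrD2l ltrN2 ltf_pV2 ?posrE ?(lt_trans ltr01)// (lt_trans _ p1).
have g0 : 0 < gamma by apply: lt_le_trans g1.
pose gm : {posnum R} := PosNum g0.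
have [C [delta [C0 d0 HC]]] := dom n.
have [C1 C10 H1] := @sparse_power_mean gm _ _ _ g1 d0 t'1 tp.
have [C2 C20 H2] := @sparse_power_mean gm _ _ _ g1 d0 s'1 sp.
set A := sup_Lmin a b s t in Aoo *.
(* One nonnegative member, here from the unit cube centred at the origin, makes the supremum
   nonnegative. *)
have A0 : 0 <= fine A.
  rewrite fine_ge0//; apply: ereal_sup_ge.
  exists (Lmin s t ((nseq_tuple d 0 : E), 1%:pos) (fun x y => \sum_(i < n) a i x * b i y)).
    by exists ((nseq_tuple d 0 : E), 1%:pos).
  by rewrite /Lmin; case: ifP => _; exact: poweR_ge0.
exists (C * (fine A * (C1 + C2))) => f g Ff Gg.
have [[Ff0 Fbf] /LfunP_Lnorm[mf Nf]] := Ff.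
have [[Gg0 Gag] /LfunP_Lnorm[mg Ng]] := Gg.
set X := 'N[mu]_(p%:E)[EFin \o f]%E in Nf *.
set Y := 'N[mu]_((conjugate_exponent p)%:E)[EFin \o g]%E in Ng *.
have X0 : (0 <= X)%E by exact: Lnorm_ge0.
have Y0 : (0 <= Y)%E by exact: Lnorm_ge0.
rewrite -(@fineK _ X) ?ge0_fin_numE// -(@fineK _ Y) ?ge0_fin_numE// -!EFinM.
have [S [SD sS]] := HC _ _ Fbf Gag.
move=> /le_trans; apply.
rewrite -!mulrA EFinM lee_wpmul2l ?lee_fin//.
(* The sum over [S] is the supremum over finite subfamilies, and the bound below does not depend on
   the subfamily. *)
apply: ge_ereal_sup => _ [Z [finZ ZS] <-].
rewrite fsbig_finite//=.
set l := finmap.enum_fset (fset_set Z).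
have lS Q : Q \in l -> S Q.
  by move=> lQ; apply: ZS; have := lQ; rewrite in_fset_set// => /set_mem.
have ul : uniq l by exact: finmap.fset_uniq.
apply: (@le_trans _ _ (\sum_(Q <- l) (fine A * (Q.2%:num ^+ d *
    (power_mean gm (conjugate_exponent t) f Q *
     power_mean gm (conjugate_exponent s) g Q)))%:E)%E).
  rewrite big_seq [leRHS]big_seq; apply: lee_sum => Q /lS/SD DQ.
  have [FX GX] := FGX _ DQ.
  rewrite lebesgueRd_cube mulrCA EFinM lee_wpmul2l ?lee_fin ?exprn_ge0//.
  exact: (@body_dot_power_mean_le gm F G n a b s t p).
rewrite sumEFin lee_fin -mulr_sumr ler_wpM2l//.
apply: (sum_young p1) => //.
- exact: fine_ge0.
- exact: fine_ge0.
- by move=> Q; exact: powR_ge0.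
- by move=> Q; exact: powR_ge0.
- exact: H1 sS mf Nf ul lS.
- exact: H2 sS mg Ng ul lS.
Qed.

End Combination.

Theorem proposition7p4 (R : realType) (d : nat) (d_gt0 : (0 < d)%N)
    (D : set (cube R d)) (dyadicD : dyadic_system D)
    (F G : set (Rd R d -> R))
    (F_space : function_space F) (G_space : function_space G)
    (T : (Rd R d -> R) -> (Rd R d -> R) -> R)
    (T_operator : operator_to_dual F G T)
    (gamma : R) (gamma_ge1 : 1 <= gamma)
    (T_domination : convex_body_domination D
       (fun Q => normalizedL 1 (dilate gamma Q))
       (fun Q => normalizedL 1 (dilate gamma Q)) F G T)
    (n : nat) (a b : 'I_n -> Rd R d -> R)
    (a_loc : forall i, Lloc1 (a i)) (b_loc : forall i, Lloc1 (b i)) :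
  (forall s t : R, 1 < s -> 1 < t ->
     (sup_Lmin a b s t < +oo)%E ->
     forall p : R, conjugate_exponent t < p -> p < s ->
       extends_boundedly F G T a b p)
  /\
  (forall s : R, 2 < s ->
     (sup_Lmin a b s s < +oo)%E ->
     extends_boundedly F G T a b 2).
Proof.
have ma i : measurable_fun setT (a i) by have [] := a_loc i.
have mb i : measurable_fun setT (b i) by have [] := b_loc i.
have main (s t : R) : 1 < s -> 1 < t -> (sup_Lmin a b s t < +oo)%E ->
    forall p : R, conjugate_exponent t < p -> p < s -> extends_boundedly F G T a b p.
  move=> s1 t1 Aoo p tp ps.
  have p1 : 1 < p by apply: lt_trans tp; exact: conjugate_gt1.
  split.
  - exact: dense_multiplier_domain.
  - by apply: dense_multiplier_domain => //; exact: conjugate_gt1.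
  - exact: multiplied_form_bounded F_space G_space gamma_ge1 T_domination
      ma mb s1 t1 Aoo tp ps.
(* For [t = s] the interval [(s', s)] contains 2 because [s > 2] gives [s' < 2]. *)
split => // s s2 Aoo; apply: (main s s) => //; try lra.
by rewrite /conjugate_exponent ltr_pdivrMr; lra.
Qed.
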